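(* Let $S$ be a smooth surface. The transformation $(D\circ A)^6$ is the identity on the set of totally isotropic immersions $\phi:S\to Q$ such that $\phi_+$ and $\phi_-$ are also immersions.
   Context: Zorn matrices. Let $\mathcal{Z}$ be the real algebra of matrices $\begin{pmatrix} a & x \\ y & b \end{pmatrix}$, $a,b\in\mathbb{R}$, $x,y\in\mathbb{R}^3$, with product $$\begin{pmatrix} a & x \\ y & b \end{pmatrix}\begin{pmatrix} a' & x' \\ y' & b' \end{pmatrix}=\begin{pmatrix} aa'+x\cdot y' & ax'+b'x-y\times y' \\ a'y+by'+x\times x' & x'\cdot y+bb' \end{pmatrix}$$ and multiplicative norm $N=ab-x\cdot y$ of signature $(4,4)$; it is a split octonion algebra. $L_Z,R_Z$ denote left and right multiplication by $Z$. For $Z\neq0$ with $N(Z)=0$, $\ker L_Z$ and $\ker R_Z$ are maximal (4-dimensional) totally isotropic subspaces; each maximal totally isotropic subspace is of exactly one of these two forms, with $Z$ unique up to scalar, and each 3-dimensional totally isotropic subspace is contained in exactly one of each form. Quadric. $\mathbb{R}^{4,4}=\mathbb{R}^3\times\mathbb{R}\times\mathbb{R}^3\times\mathbb{R}$ carries $q(x,s,y,t)=x\cdot y+st$, and $Q=\{(x:s:y:t): x\cdot y+st=0\}\subset P(\mathbb{R}^{4,4})=\mathbb{R}P^7$. The linear isomorphism $\rho:\mathbb{R}^{4,4}\to\mathcal{Z}$, $\rho(x,s,y,t)=\begin{pmatrix} s & x \\ y & -t \end{pmatrix}$, satisfies $N\circ\rho=-q$ and identifies $Q$ with the quadric of isotropic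 lines of $\mathcal{Z}$. A smooth map $\phi:S\to Q$ is totally isotropic if for every local lift $\psi:S\to\mathbb{R}^{4,4}\setminus\{0\}$ and every $p$, the subspace $V_p=\mathbb{R}\psi(p)+\mathrm{im}\,d\psi(p)$ is totally isotropic; if $\phi$ is an immersion, $\dim V_p=3$. For a totally isotropic immersion $\phi:S\to Q$, the maps $\phi_\pm:S\to Q$ are defined by: $\phi_+(p)\in Q$ is the point such that $\rho(\phi_+(p))=\mathbb{R}Z_+$ with $\ker L_{Z_+}\supset\rho(V_p)$, and $\phi_-(p)\in Q$ is the point such that $\rho(\phi_-(p))=\mathbb{R}Z_-$ with $\ker R_{Z_-}\supset\rho(V_p)$. They are smooth and totally isotropic. Transformations. Let $c,\sigma:Q\to Q$ be the projective involutions $c(x:s:y:t)=(x:t:y:s)$ and $\sigma(x:s:y:t)=(y:s:x:t)$. For a totally isotropic immersion $\phi:S\to Q$ set $A(\phi)=c\circ\phi_+$ and $D(\phi)=\sigma\circ\phi$. *)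

(* Defs.v *)
(* MathComp / MathComp-Analysis, over an arbitrary [R : realType]. *)
From HB Require Import structures.
From mathcomp Require Import all_boot all_order all_algebra.
From mathcomp Require Import all_classical all_reals all_analysis.
Set Implicit Arguments.
Unset Strict Implicit.
Unset Printing Implicit Defensive.
Import Order.TTheory GRing.Theory Num.Theory.
Import numFieldNormedType.Exports.
Local Open Scope classical_set_scope.
Local Open Scope ring_scope.

(** ** Linear algebra: Zorn matrices and R^{4,4} *)

Definition dotprod (R : realType) (x y : 'rV[R]_3) : R :=
  \sum_(i < 3) x 0 i * y 0 i.

(* The index additions are those of the ring structure on ['I_3], that is,
   modulo 3. *)
Definition crossprod (R : realType) (x y : 'rV[R]_3) : 'rV[R]_3 :=
  \row_(i < 3) (x 0 (i + 1) * y 0 (i + 2%:R) - x 0 (i + 2%:R) * y 0 (i + 1)).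

(* [(a, x, y, b)] stands for the matrix with rows [a x] and [y b].  The factor
   [R^o] is [R] seen as a normed space over itself. *)
Definition zorn (R : realType) : normedModType R :=
  (R^o * 'rV[R]_3 * 'rV[R]_3 * R^o)%type.

Definition zmul (R : realType) (Z Z' : zorn R) : zorn R :=
  let '(a, x, y, b) := Z in
  let '(a', x', y', b') := Z' in
  (a * a' + dotprod x y',
   a *: x' + b' *: x - crossprod y y',
   a' *: y + b *: y' + crossprod x x',
   dotprod x' y + b * b').

Definition kerL (R : realType) (Z : zorn R) : set (zorn R) :=
  [set W | zmul Z W = 0].

Definition kerR (R : realType) (Z : zorn R) : set (zorn R) :=
  [set W | zmul W Z = 0].

Notation R44 R := ('rV[R]_3 * R^o * 'rV[R]_3 * R^o)%type.

Definition qform (R : realType) (v : R44 R) : R :=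
  let '(x, s, y, t) := v in dotprod x y + s * t.

Definition rho (R : realType) (v : R44 R) : zorn R :=
  let '(x, s, y, t) := v in (s, x, y, - t).

Definition totally_isotropic_space (R : realType) (V : {vspace R44 R}) : Prop :=
  forall v, v \in V -> qform v = 0.

(* A point of the projective space is a one-dimensional subspace. *)
Definition in_quadric (R : realType) (L : {vspace R44 R}) : bool :=
  (\dim L == 1)%N && `[< totally_isotropic_space L >].

Definition quadric (R : realType) : choiceType :=
  {L : {vspace R44 R} | in_quadric L}.

(** ** The projective involutions c and sigma *)

Definition c_vec (R : realType) (v : R44 R) : R44 R :=
  let '(x, s, y, t) := v in (x, t, y, s).

Definition sigma_vec (R : realType) (v : R44 R) : R44 R :=
  let '(x, s, y, t) := v in (y, s, x, t).

Lemma c_vec_is_linear (R : realType) : linear (@c_vec R).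
Proof. by move=> k [[[x s] y] t] [[[x' s'] y'] t']. Qed.

HB.instance Definition _ (R : realType) :=
  GRing.isLinear.Build R (R44 R) (R44 R) _ (@c_vec R) (@c_vec_is_linear R).

Lemma sigma_vec_is_linear (R : realType) : linear (@sigma_vec R).
Proof. by move=> k [[[x s] y] t] [[[x' s'] y'] t']. Qed.

HB.instance Definition _ (R : realType) :=
  GRing.isLinear.Build R (R44 R) (R44 R) _ (@sigma_vec R)
    (@sigma_vec_is_linear R).

Lemma c_vecK (R : realType) : involutive (@c_vec R).
Proof. by move=> [[[x s] y] t]. Qed.

Lemma sigma_vecK (R : realType) : involutive (@sigma_vec R).
Proof. by move=> [[[x s] y] t]. Qed.

Lemma qform_c_vec (R : realType) (v : R44 R) : qform (c_vec v) = qform v.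
Proof. by case: v => [[[x s] y] t] /=; rewrite mulrC. Qed.

Lemma qform_sigma_vec (R : realType) (v : R44 R) :
  qform (sigma_vec v) = qform v.
Proof.
case: v => [[[x s] y] t] /=; congr (_ + _).
by apply: eq_bigr => i _; rewrite mulrC.
Qed.

Lemma in_quadric_img (R : realType) (f : {linear R44 R -> R44 R})
    (fK : involutive f) (fq : forall v, qform (f v) = qform v) (z : quadric R) :
  in_quadric (linfun f @: val z)%VS.
Proof.
case: z => L /= /andP[/eqP dL /asboolP qL]; apply/andP; split.
  rewrite limg_dim_eq ?dL //; apply/eqP; rewrite -subv0.
  apply/subvP => v; rewrite memv_cap memv_ker lfunE memv0 => /andP[_ /eqP fv0].
  by rewrite -(fK v) /= fv0 linear0.
by apply/asboolP => _ /memv_imgP[v vL ->]; rewrite lfunE /= fq qL.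
Qed.

Definition c_map (R : realType) (z : quadric R) : quadric R :=
  Sub (linfun (@c_vec R) @: val z)%VS
    (in_quadric_img (@c_vecK R) (@qform_c_vec R) z).

Definition sigma_map (R : realType) (z : quadric R) : quadric R :=
  Sub (linfun (@sigma_vec R) @: val z)%VS
    (in_quadric_img (@sigma_vecK R) (@qform_sigma_vec R) z).

(** ** Smooth surfaces *)

Fixpoint Ck_on (R : realType) (V : normedModType R) (k : nat)
    (U : set 'rV[R]_2) (f : 'rV[R]_2 -> V) : Prop :=
  match k with
  | 0 => forall x, U x -> {for x, continuous f}
  | k'.+1 => (forall x, U x -> differentiable f x) /\
             (forall h, Ck_on k' U (fun x => 'd f x h))
  end.

(* [U] is meant to be open. *)
Definition smooth_on (R : realType) (V : normedModType R) (U : set 'rV[R]_2)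
    (f : 'rV[R]_2 -> V) : Prop :=
  forall k, Ck_on k U f.

(* The maps are total; only their values on [chart_dom] and on its image
   matter. *)
Record chart (R : realType) (T : topologicalType) := Chart {
  chart_dom : set T;
  chart_map : T -> 'rV[R]_2;
  chart_inv : 'rV[R]_2 -> T;
  chart_dom_open : open chart_dom;
  chart_img_open : open (chart_map @` chart_dom);
  chart_mapK : {in chart_dom, cancel chart_map chart_inv};
  chart_map_continuous : {within chart_dom, continuous chart_map};
  chart_inv_continuous : {within chart_map @` chart_dom, continuous chart_inv}
}.

Record smooth_surface (R : realType) := SmoothSurface {
  surface_space :> topologicalType;
  surface_hausdorff : hausdorff_space surface_space;
  surface_second_countable : @second_countable surface_space;
  atlas : set (chart R surface_space);
  atlas_cover : forall p, exists2 a, atlas a & chart_dom a p;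
  atlas_compatible : forall a b, atlas a -> atlas b ->
    smooth_on (chart_map a @` (chart_dom a `&` chart_dom b))
              (chart_map b \o chart_inv a)
}.

Definition surface_smooth_on (R : realType) (S : smooth_surface R)
    (V : normedModType R) (W : set S) (f : S -> V) : Prop :=
  forall a, atlas a ->
    smooth_on (chart_map a @` (chart_dom a `&` W)) (f \o chart_inv a).

(** ** Maps from a surface to the quadric *)

(* [psi] is total, but it is a lift of [phi] over the open set [W] only. *)
Definition local_lift (R : realType) (S : smooth_surface R)
    (phi : S -> quadric R) (W : set S) (psi : S -> R44 R) : Prop :=
  [/\ open W, surface_smooth_on W psi &
      forall p, W p -> psi p != 0 /\ val (phi p) = <[psi p]>%VS].

(* The smooth structure of the projective space is the one for which
   [v |-> <[v]>] is a submersion on nonzero vectors: a map to it is smooth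
   when it has smooth lifts around every point. *)
Definition smooth_map (R : realType) (S : smooth_surface R)
    (phi : S -> quadric R) : Prop :=
  forall p, exists W psi, W p /\ local_lift phi W psi.

Definition chart_diff (R : realType) (S : smooth_surface R)
    (psi : S -> R44 R) (a : chart R S) (p : S) : 'rV[R]_2 -> R44 R :=
  'd (psi \o chart_inv a) (chart_map a p).

(* [V] is the space V_p computed from some local lift and some chart around
   [p]; when [phi] is smooth there is exactly one such [V]. *)
Definition is_tangent_span (R : realType) (S : smooth_surface R)
    (phi : S -> quadric R) (p : S) (V : {vspace R44 R}) : Prop :=
  exists W psi a,
    [/\ local_lift phi W psi, W p, atlas a, chart_dom a p &
        V = (<[psi p]> + limg (linfun (chart_diff psi a p)))%VS].

Definition totally_isotropic (R : realType) (S : smooth_surface R)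
    (phi : S -> quadric R) : Prop :=
  smooth_map phi /\
  forall p V, is_tangent_span phi p V -> totally_isotropic_space V.

(* The differential at [v] of [v |-> <[v]>] has kernel [<[v]>], so the
   differential of [phi] at [p] is that of [psi] modulo [psi p]. *)
Definition immersion (R : realType) (S : smooth_surface R)
    (phi : S -> quadric R) : Prop :=
  smooth_map phi /\
  forall W psi a p,
    local_lift phi W psi -> W p -> atlas a -> chart_dom a p ->
    forall h, chart_diff psi a p h \in <[psi p]>%VS -> h = 0.

Definition totally_isotropic_immersion (R : realType) (S : smooth_surface R)
    (phi : S -> quadric R) : Prop :=
  totally_isotropic phi /\ immersion phi.

Definition spanned_by (R : realType) (z : quadric R) (Z : zorn R) : Prop :=
  [set rho v | v in [set v | v \in val z]] = [set k *: Z | k in [set: R]].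

(* [phi p] is a dummy default value: when [phi] is a totally isotropic
   immersion exactly one point satisfies the condition. *)
Definition phi_plus (R : realType) (S : smooth_surface R)
    (phi : S -> quadric R) (p : S) : quadric R :=
  xget (phi p) [set z | exists2 Z, spanned_by z Z &
    forall V, is_tangent_span phi p V ->
      [set rho v | v in [set v | v \in V]] `<=` kerL Z].

Definition phi_minus (R : realType) (S : smooth_surface R)
    (phi : S -> quadric R) (p : S) : quadric R :=
  xget (phi p) [set z | exists2 Z, spanned_by z Z &
    forall V, is_tangent_span phi p V ->
      [set rho v | v in [set v | v \in V]] `<=` kerR Z].

(** ** The transformations, defined on totally isotropic immersions only *)

Definition transfA (R : realType) (S : smooth_surface R)
    (phi : S -> quadric R) : option (S -> quadric R) :=
  if `[< totally_isotropic_immersion phi >]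
  then Some (@c_map R \o phi_plus phi) else None.

Definition transfD (R : realType) (S : smooth_surface R)
    (phi : S -> quadric R) : option (S -> quadric R) :=
  if `[< totally_isotropic_immersion phi >]
  then Some (@sigma_map R \o phi) else None.

Definition transfDA (R : realType) (S : smooth_surface R)
    (phi : S -> quadric R) : option (S -> quadric R) :=
  obind (@transfD R S) (transfA phi).

(* Main.v *)
(** In the Zorn algebra a tangent space [V] of [phi] is contained in [ker L_Z+]
    and [ker R_Z-].  Differentiating [Z+ phi = 0] gives [dZ+ phi = 0], so
    [phi_plus phi] is again totally isotropic, and likewise [phi dZ- = 0] says
    that the plus transform of [phi_minus phi] is [phi].  The point is that
    [Z- dZ+ = 0], i.e. that the plus transform of [phi_plus phi] is
    [phi_minus phi]: differentiating [Z+ dphi = 0] expresses [dZ+ dphi] by the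
    second derivatives of [phi], which are orthogonal to [V] because
    [<d_i d_j phi, d_k phi>] is symmetric in [i], [j] and antisymmetric in [j],
    [k]; the rest is algebra, checked on one standard [V] after moving any [V]
    there by reflections, which act on both kernels by the Moufang identities.
    So [phi -> phi_plus phi] has order 3.  Both [c] and [sigma] are, up to sign,
    anti-automorphisms of the Zorn algebra, hence [sigma \o c] commutes with
    [phi -> phi_plus phi]; being an involution, it turns the order 3 into 6. *)
Require Import Defs.
From HB Require Import structures.
From mathcomp Require Import all_boot all_order all_algebra.
From mathcomp Require Import all_classical all_reals all_analysis.
From mathcomp Require Import ring lra.
Set Implicit Arguments.
Unset Strict Implicit.
Unset Printing Implicit Defensive.
Import Order.TTheory GRing.Theory Num.Theory.
Import numFieldNormedType.Exports.
Local Open Scope classical_set_scope.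
Local Open Scope ring_scope.

(** * The Zorn algebra *)

Section ZornCoordinates.
Variable R : realType.
Implicit Types (X Y Z : zorn R).

Definition row3 (a b c : R) : 'rV[R]_3 := \row_(i < 3) [:: a; b; c]`_i.

Lemma row3P (x : 'rV[R]_3) : exists a b c, x = row3 a b c.
Proof.
exists (x 0 0), (x 0 1), (x 0 2%:R); apply/rowP => i; rewrite !mxE.
by case: i => [[|[|[|//]]] ?] /=; congr (x _ _); apply: val_inj.
Qed.

Lemma row3_inj a b c a' b' c' :
  row3 a b c = row3 a' b' c' -> [/\ a = a', b = b' & c = c'].
Proof.
by move=> /rowP e; move: (e 0) (e 1) (e 2%:R); rewrite !mxE.
Qed.

Lemma row3_0 : 0 = row3 0 0 0.
Proof. by apply/rowP => i; rewrite !mxE; case: i => [[|[|[|//]]] ?]. Qed.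

Lemma row3D a b c a' b' c' :
  row3 a b c + row3 a' b' c' = row3 (a + a') (b + b') (c + c').
Proof. by apply/rowP => i; rewrite !mxE; case: i => [[|[|[|//]]] ?]. Qed.

Lemma row3N a b c : - row3 a b c = row3 (- a) (- b) (- c).
Proof. by apply/rowP => i; rewrite !mxE; case: i => [[|[|[|//]]] ?]. Qed.

Lemma row3Z k a b c : k *: row3 a b c = row3 (k * a) (k * b) (k * c).
Proof. by apply/rowP => i; rewrite !mxE; case: i => [[|[|[|//]]] ?]. Qed.

Lemma dotprod3 a b c a' b' c' :
  dotprod (row3 a b c) (row3 a' b' c') = a * a' + b * b' + c * c'.
Proof.
by rewrite /dotprod !big_ord_recl big_ord0 !mxE /= addr0 !addrA.
Qed.

Lemma crossprod3 a b c a' b' c' :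
  crossprod (row3 a b c) (row3 a' b' c') =
  row3 (b * c' - c * b') (c * a' - a * c') (a * b' - b * a').
Proof. by apply/rowP => i; rewrite !mxE; case: i => [[|[|[|//]]] ?]. Qed.

(** Eight scalar coordinates: once all arguments have this form, [zring] splits an identity of the
    algebra into polynomial ones. *)
Definition zo (a x y z u v w b : R) : zorn R := (a, row3 x y z, row3 u v w, b).

Lemma zoP Z : exists a x y z u v w b, Z = zo a x y z u v w b.
Proof.
case: Z => [[[a x] y] b].
have [x1 [x2 [x3 ->]]] := row3P x; have [y1 [y2 [y3 ->]]] := row3P y.
by exists a, x1, x2, x3, y1, y2, y3, b.
Qed.

Lemma zo_inj a x y z u v w b a' x' y' z' u' v' w' b' :
  zo a x y z u v w b = zo a' x' y' z' u' v' w' b' ->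
  [/\ a = a', [/\ x = x', y = y' & z = z'], [/\ u = u', v = v' & w = w'] & b = b'].
Proof. by case=> -> /row3_inj ? /row3_inj ? ->. Qed.

Lemma eq_zo a x y z u v w b a' x' y' z' u' v' w' b' :
  a = a' -> x = x' -> y = y' -> z = z' -> u = u' -> v = v' -> w = w' -> b = b' ->
  zo a x y z u v w b = zo a' x' y' z' u' v' w' b'.
Proof. by move=> -> -> -> -> -> -> -> ->. Qed.

Lemma zo0 : 0 = zo 0 0 0 0 0 0 0 0.
Proof. by rewrite /zo -!row3_0. Qed.

Lemma zoD a x y z u v w b a' x' y' z' u' v' w' b' :
  zo a x y z u v w b + zo a' x' y' z' u' v' w' b' =
  zo (a + a') (x + x') (y + y') (z + z') (u + u') (v + v') (w + w') (b + b').
Proof. by rewrite /zo -!row3D. Qed.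

Lemma zoN a x y z u v w b :
  - zo a x y z u v w b = zo (- a) (- x) (- y) (- z) (- u) (- v) (- w) (- b).
Proof. by rewrite /zo -!row3N. Qed.

Lemma zoZ k a x y z u v w b :
  k *: zo a x y z u v w b =
  zo (k * a) (k * x) (k * y) (k * z) (k * u) (k * v) (k * w) (k * b).
Proof. by rewrite /zo -!row3Z. Qed.

Lemma zmulE a x y z u v w b a' x' y' z' u' v' w' b' :
  zmul (zo a x y z u v w b) (zo a' x' y' z' u' v' w' b') =
  zo (a * a' + (x * u' + y * v' + z * w'))
     (a * x' + b' * x - (v * w' - w * v'))
     (a * y' + b' * y - (w * u' - u * w'))
     (a * z' + b' * z - (u * v' - v * u'))
     (a' * u + b * u' + (y * z' - z * y'))
     (a' * v + b * v' + (z * x' - x * z'))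
     (a' * w + b * w' + (x * y' - y * x'))
     (x' * u + y' * v + z' * w + b * b').
Proof.
by rewrite /zo /zmul !dotprod3 !crossprod3 !row3N !row3Z !row3D.
Qed.

(** Octonion conjugation: [Z + zconj Z] and [zmul Z (zconj Z)] are scalar matrices, given by the
    trace and the norm of [Z]. *)
Definition zconj Z : zorn R := let '(a, x, y, b) := Z in (b, - x, - y, a).
Definition znorm Z : R := let '(a, x, y, b) := Z in a * b - dotprod x y.
Definition zbil Z Z' : R := znorm (Z + Z') - znorm Z - znorm Z'.

Lemma zconjE a x y z u v w b :
  zconj (zo a x y z u v w b) = zo b (- x) (- y) (- z) (- u) (- v) (- w) a.
Proof. by rewrite /zconj /zo -!row3N. Qed.

Lemma znormE a x y z u v w b :
  znorm (zo a x y z u v w b) = a * b - (x * u + y * v + z * w).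
Proof. by rewrite /znorm /zo dotprod3. Qed.

Lemma zbilE a x y z u v w b a' x' y' z' u' v' w' b' :
  zbil (zo a x y z u v w b) (zo a' x' y' z' u' v' w' b') =
  a * b' + a' * b - (x * u' + y * v' + z * w') - (x' * u + y' * v + z' * w).
Proof. by rewrite /zbil zoD !znormE; ring. Qed.

End ZornCoordinates.

Ltac zcoord Z := destruct (zoP Z) as (? & ? & ? & ? & ? & ? & ? & ? & ->).
Ltac zring :=
  rewrite ?zo0 ?(zmulE, zconjE, zoD, zoN, zoZ, znormE, zbilE);
  first [ring | apply: eq_zo; ring].

(** * Octonion identities and reflections *)

Section ZornAlgebra.
Variable R : realType.
Implicit Types (u v w X Y Z A : zorn R) (k : R).

Lemma zmulDl X Y Z : zmul (X + Y) Z = zmul X Z + zmul Y Z.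
Proof. by zcoord X; zcoord Y; zcoord Z; zring. Qed.

Lemma zmulDr X Y Z : zmul X (Y + Z) = zmul X Y + zmul X Z.
Proof. by zcoord X; zcoord Y; zcoord Z; zring. Qed.

Lemma zmulZl k X Y : zmul (k *: X) Y = k *: zmul X Y.
Proof. by zcoord X; zcoord Y; zring. Qed.

Lemma zmulZr k X Y : zmul X (k *: Y) = k *: zmul X Y.
Proof. by zcoord X; zcoord Y; zring. Qed.

Lemma zmul0l X : zmul 0 X = 0.
Proof. by rewrite -[X in zmul X _](scale0r 0) zmulZl scale0r. Qed.

Lemma zmul0r X : zmul X 0 = 0.
Proof. by rewrite -[X in zmul _ X](scale0r 0) zmulZr scale0r. Qed.

Lemma zmulNl X Y : zmul (- X) Y = - zmul X Y.
Proof. by rewrite -scaleN1r zmulZl scaleN1r. Qed.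

Lemma zmulNr X Y : zmul X (- Y) = - zmul X Y.
Proof. by rewrite -scaleN1r zmulZr scaleN1r. Qed.

Lemma zconjK : involutive (@zconj R).
Proof. by move=> X; zcoord X; rewrite !zconjE !opprK. Qed.

Lemma zconjD X Y : zconj (X + Y) = zconj X + zconj Y.
Proof. by zcoord X; zcoord Y; zring. Qed.

Lemma zconjZ k X : zconj (k *: X) = k *: zconj X.
Proof. by zcoord X; zring. Qed.

Lemma zconjN X : zconj (- X) = - zconj X.
Proof. by zcoord X; zring. Qed.

Lemma zconj0 : zconj 0 = 0 :> zorn R.
Proof. by zring. Qed.

(** Conjugation exchanges left and right annihilators, so [killsr] can be treated through [killsl]
    of the conjugated frame. *)
Lemma zconj_mul X Y : zconj (zmul X Y) = zmul (zconj Y) (zconj X).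
Proof. by zcoord X; zcoord Y; zring. Qed.

Lemma znorm_conj X : znorm (zconj X) = znorm X.
Proof. by zcoord X; zring. Qed.

Lemma zbil_conj X Y : zbil (zconj X) (zconj Y) = zbil X Y.
Proof. by zcoord X; zcoord Y; zring. Qed.

(** A substitute for associativity: multiplication by a non-null [X] is invertible, and a zero
    product with one nonzero factor forces the other factor to be null. *)
Lemma zmul_conjKl X Y : zmul (zconj X) (zmul X Y) = znorm X *: Y.
Proof. by zcoord X; zcoord Y; zring. Qed.

Lemma zmul_conjKr X Y : zmul (zmul Y X) (zconj X) = znorm X *: Y.
Proof. by zcoord X; zcoord Y; zring. Qed.

Lemma zbilC X Y : zbil X Y = zbil Y X.
Proof. by rewrite /zbil [X + Y]addrC addrAC. Qed.

Lemma zbilDl X Y Z : zbil (X + Y) Z = zbil X Z + zbil Y Z.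
Proof. by zcoord X; zcoord Y; zcoord Z; zring. Qed.

Lemma zbilZl k X Y : zbil (k *: X) Y = k * zbil X Y.
Proof. by zcoord X; zcoord Y; zring. Qed.

Lemma zbilDr X Y Z : zbil Z (X + Y) = zbil Z X + zbil Z Y.
Proof. by rewrite zbilC zbilDl !(zbilC Z). Qed.

Lemma zbilZr k X Y : zbil Y (k *: X) = k * zbil Y X.
Proof. by rewrite zbilC zbilZl zbilC. Qed.

Lemma zbilNl X Y : zbil (- X) Y = - zbil X Y.
Proof. by rewrite -scaleN1r zbilZl mulN1r. Qed.

Lemma zbilNr X Y : zbil Y (- X) = - zbil Y X.
Proof. by rewrite -scaleN1r zbilZr mulN1r. Qed.

Lemma zbilxx X : zbil X X = 2 * znorm X.
Proof. by zcoord X; zring. Qed.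

Lemma znormZ k X : znorm (k *: X) = k ^+ 2 * znorm X.
Proof. by zcoord X; zring. Qed.

Lemma znormD X Y : znorm (X + Y) = znorm X + znorm Y + zbil X Y.
Proof. by rewrite /zbil; ring. Qed.

Lemma znorm_killed Z v : v != 0 -> zmul Z v = 0 -> znorm Z = 0.
Proof.
move=> v0 Zv; apply: contraNeq v0 => nZ.
have := zmul_conjKl Z v; rewrite Zv zmul0r => /esym/eqP.
by rewrite scaler_eq0 (negPf nZ).
Qed.

Lemma znorm_killer Y v : v != 0 -> zmul v Y = 0 -> znorm Y = 0.
Proof.
move=> v0 vY; apply: contraNeq v0 => nY.
have := zmul_conjKr Y v; rewrite vY zmul0l => /esym/eqP.
by rewrite scaler_eq0 (negPf nY).
Qed.

(** The reflection in the hyperplane orthogonal to [u]; the usual factor 2 is absorbed by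
    [zbil u u = 2 * znorm u]. *)
Definition zrefl u v : zorn R := v - (zbil v u / znorm u) *: u.

(* Equal to [v |-> - u v u / znorm u]. *)
Definition zbimul u v : zorn R := zconj v - (zbil v (zconj u) / znorm u) *: u.

Lemma zbimul_refl u v : zbimul u (zconj v) = zrefl u v.
Proof. by rewrite /zbimul /zrefl zconjK zbil_conj. Qed.

Lemma zrefl_bimul u v : zconj (zrefl (zconj u) v) = zbimul u v.
Proof. by rewrite /zbimul /zrefl zconjD zconjN zconjZ zconjK znorm_conj. Qed.

(* Moufang identities, up to scalars: (X u^-1)(u v u) = (X v) u,
   (u v u)(u^-1 Y) = u (v Y) and, below, (u Y)(X u) = u (Y X) u. *)
Lemma zmul_bimul_killed u v X : znorm u != 0 ->
  zmul (zmul X (zconj u)) (zbimul u v) = - zmul (zmul X v) u.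
Proof.
move=> nu; rewrite /zbimul zmulDr zmulNr zmulZr [_ / znorm u]mulrC -scalerA.
(* Multiplying by [znorm u] clears the only denominator and leaves a polynomial identity. *)
apply: (scalerI nu); rewrite scalerBr scalerN [znorm u *: (_ *: (_ *: _))]scalerA mulfV // scale1r.
by zcoord X; zcoord u; zcoord v; zring.
Qed.

Lemma zmul_bimul_killer u v Y : znorm u != 0 ->
  zmul (zbimul u v) (zmul (zconj u) Y) = - zmul u (zmul v Y).
Proof.
move=> nu; rewrite /zbimul zmulDl zmulNl zmulZl [_ / znorm u]mulrC -scalerA.
apply: (scalerI nu); rewrite scalerBr scalerN [znorm u *: (_ *: (_ *: _))]scalerA mulfV // scale1r.
by zcoord Y; zcoord u; zcoord v; zring.
Qed.

Lemma zmul_moufang u X Y :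
  zmul (zmul u Y) (zmul X u) = zmul u (zmul (zmul Y X) u).
Proof. by zcoord X; zcoord Y; zcoord u; zring. Qed.

Lemma zmulIr u X : znorm u != 0 -> zmul X u = 0 -> X = 0.
Proof.
move=> nu Xu; apply: (scalerI nu); rewrite scaler0.
by rewrite -zmul_conjKr Xu zmul0l.
Qed.

Lemma zmulIl u X : znorm u != 0 -> zmul u X = 0 -> X = 0.
Proof.
move=> nu uX; apply: (scalerI nu); rewrite scaler0.
by rewrite -zmul_conjKl uX zmul0r.
Qed.

Lemma zreflD u v w : zrefl u (v + w) = zrefl u v + zrefl u w.
Proof. by rewrite /zrefl zbilDl mulrDl scalerDl opprD addrACA. Qed.

Lemma zreflZ k u v : zrefl u (k *: v) = k *: zrefl u v.
Proof. by rewrite /zrefl zbilZl scalerBr scalerA mulrA. Qed.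

Lemma zbil_refl u v w : znorm u != 0 -> zbil (zrefl u v) (zrefl u w) = zbil v w.
Proof.
move=> nu; rewrite /zrefl !zbilDl !zbilDr !zbilNl !zbilNr !zbilZl !zbilZr.
by rewrite zbilxx (zbilC u w); field.
Qed.

Lemma zreflK u : znorm u != 0 -> involutive (zrefl u).
Proof.
move=> nu v; rewrite /zrefl zbilDl zbilNl zbilZl zbilxx.
rewrite -addrA -opprD -scalerDl.
suff -> : zbil v u / znorm u + (zbil v u - zbil v u / znorm u * (2 * znorm u)) / znorm u = 0.
  by rewrite scale0r subr0.
by field.
Qed.

Lemma zrefl_orth u v : zbil v u = 0 -> zrefl u v = v.
Proof. by rewrite /zrefl => ->; rewrite mul0r scale0r subr0. Qed.

(** Since both vectors are null, [zbil v (v - w)] and [znorm (v - w)] both equal [- zbil v w], so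
    the reflection subtracts exactly [v - w]. *)
Lemma zrefl_swap v w : znorm v = 0 -> znorm w = 0 -> zbil v w != 0 ->
  znorm (v - w) != 0 /\ zrefl (v - w) v = w.
Proof.
move=> nv nw bvw; have nu : znorm (v - w) = - zbil v w.
  by rewrite znormD nv zbilNr -scaleN1r znormZ nw mulr0 !add0r.
split; first by rewrite nu oppr_eq0.
rewrite /zrefl nu zbilDr zbilNr zbilxx nv mulr0 sub0r mulfV ?oppr_eq0 //.
by rewrite scale1r opprB addrC subrK.
Qed.

End ZornAlgebra.

Arguments zmul : simpl never.
Arguments zconj : simpl never.
Arguments znorm : simpl never.
Arguments zbil : simpl never.
Arguments zbimul : simpl never.
Arguments zrefl : simpl never.

(** * Isotropic 3-spaces and their annihilators *)

Section Triality.
Variable R : realType.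
Implicit Types (u w X Y Z A : zorn R) (k : R) (v : 'I_3 -> zorn R).

Definition killsl Z v := forall i, zmul Z (v i) = 0.
Definition killsr Y v := forall i, zmul (v i) Y = 0.

(* For the frame [v] of a tangent space, [Z] and [Y] represent phi_+ and phi_-,
   and [half_triality_tri] applies to [A = dZ].  The case [A = Z] is
   [zmul Y Z = 0]. *)
Record half_triality v : Prop := HalfTriality {
  half_triality_ex : exists2 Z, Z != 0 & killsl Z v;
  half_triality_uniq : forall Z Z',
    Z != 0 -> killsl Z v -> killsl Z' v -> exists k, Z' = k *: Z;
  half_triality_tri : forall Z Y A, killsl Z v -> killsr Y v ->
    (forall i, exists2 w, forall j, zbil (v j) w = 0 & zmul A (v i) = zmul Z w) ->
    zmul Y A = 0
}.

(** The conjugated half takes care of right annihilators. A reflection exchanges the two halves, so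
    only their conjunction can be transported along reflections. *)
Definition triality v := half_triality v /\ half_triality (@zconj R \o v).

(** Right multiplication by [zconj u] carries the left annihilators of [v] to those of the new
    frame, and left multiplication by [zconj u] does so for right annihilators; both are bijective
    because [u] is not null. *)
Lemma half_triality_bimul u v : znorm u != 0 ->
  half_triality (zbimul u \o v) -> half_triality v.
Proof.
move=> nu; have nu' : znorm (zconj u) != 0 by rewrite znorm_conj.
have kl Z : killsl Z v -> killsl (zmul Z (zconj u)) (zbimul u \o v).
  by move=> Zv i /=; rewrite zmul_bimul_killed // Zv zmul0l oppr0.
move=> [[Z1 Z10 Z1v] U T]; split.
- exists (zmul Z1 u); first by apply: contraNneq Z10 => /zmulIr ->.
  move=> i; apply: (zmulIr nu); apply: oppr_inj.
  rewrite oppr0 -zmul_bimul_killed //.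
  by rewrite zmul_conjKr zmulZl [zmul _ _]Z1v scaler0.
- move=> Z Z' Z0 Zv Z'v.
  have Zu0 : zmul Z (zconj u) != 0 by apply: contraNneq Z0 => /zmulIr ->.
  have [k kE] := U _ _ Zu0 (kl _ Zv) (kl _ Z'v).
  exists k; apply/eqP; rewrite -subr_eq0; apply/eqP/(zmulIr nu').
  by rewrite zmulDl zmulNl kE zmulZl subrr.
- move=> Z Y A Zv vY H.
  (* By [zmul_moufang] this product is [zmul Y A] multiplied on both sides by the invertible
     [zconj u]. *)
  have : zmul (zmul (zconj u) Y) (zmul A (zconj u)) = 0.
    apply: (T (zmul Z (zconj u))) => [|i /=|i]; first exact: kl.
      by rewrite zmul_bimul_killer // vY zmul0r oppr0.
    have [w vw Aw] := H i; exists (zbimul u w) => [j|] /=.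
      (* [zbimul u] is a reflection followed by conjugation, hence an isometry, and orthogonality to
         the frame survives. *)
      by rewrite -zrefl_bimul -[zbimul u w]zrefl_bimul zbil_conj zbil_refl.
    by rewrite !zmul_bimul_killed // Aw.
  by rewrite zmul_moufang => /(zmulIl nu') /(zmulIr nu').
Qed.

(** A reflection is conjugation followed by [zbimul u], and also [zbimul (zconj u)] followed by
    conjugation: each half for the reflected frame yields the other half for [v]. *)
Lemma triality_refl u v : znorm u != 0 -> triality (zrefl u \o v) -> triality v.
Proof.
move=> nu [h1 h2]; split.
  apply: (@half_triality_bimul (zconj u)); first by rewrite znorm_conj.
  congr half_triality: h2; apply/funext => i /=.
  by rewrite -zrefl_bimul zconjK.
apply: (@half_triality_bimul u) => //.
congr half_triality: h1; apply/funext => i /=.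
by rewrite zbimul_refl.
Qed.

Definition zstd (i : 'I_3) : zorn R :=
  zo 0 (i == 0)%:R (i == 1)%:R (i == 2%:R)%:R 0 0 0 0.

(** Here the annihilators are explicit: left ones live in the lower right corner, right ones in the
    upper left corner. The factor [k] serves both halves, because conjugation maps [zstd] to its
    opposite. *)
Lemma half_triality_std k : k != 0 -> half_triality (fun i => k *: zstd i).
Proof.
move=> k0.
have kl Z : killsl Z (fun i => k *: zstd i) -> exists b, Z = zo 0 0 0 0 0 0 0 b.
  move=> Zv; have Zi i : zmul Z (zstd i) = 0.
    by apply: (scalerI k0); rewrite -zmulZr Zv scaler0.
  move: (Zi 0) (Zi 1) (Zi 2%:R); zcoord Z; rewrite /zstd /= !zmulE zo0.
  move=> /zo_inj [? [? ? ?] [? ? ?] ?] /zo_inj [? [? ? ?] [? ? ?] ?].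
  move=> /zo_inj [? [? ? ?] [? ? ?] ?].
  by eexists; apply: eq_zo; [lra..|reflexivity].
split.
- exists (zo 0 0 0 0 0 0 0 1).
    by rewrite zo0; apply/eqP => /zo_inj [_ _ _ /eqP]; rewrite oner_eq0.
  by move=> i; rewrite /zstd; zring.
- move=> Z Z' Z0 /kl[b ?] /kl[b' ?]; subst Z Z'.
  have b0 : b != 0 by apply: contraNneq Z0 => ->; rewrite zo0.
  by exists (b' / b); rewrite zoZ !mulr0 divfK.
- move=> Z Y A /kl[b ?] vY H; subst Z.
  have Yi i : zmul (zstd i) Y = 0.
    by apply: (scalerI k0); rewrite -zmulZl vY scaler0.
  have : exists a, Y = zo a 0 0 0 0 0 0 0.
    move: (Yi 0) (Yi 1) (Yi 2%:R); move: (Y) => Y'; zcoord Y'; rewrite /zstd /= !zmulE zo0.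
    move=> /zo_inj [? [? ? ?] [? ? ?] ?] /zo_inj [? [? ? ?] [? ? ?] ?].
    move=> /zo_inj [? [? ? ?] [? ? ?] ?].
    by eexists; apply: eq_zo; [reflexivity|lra..].
  case=> a ->.
  (* Orthogonality to the frame kills the lower vector part of [w], so [zmul Z w] keeps only its
     lower right entry. *)
  have Ai i : exists c, zmul A (zstd i) = zo 0 0 0 0 0 0 0 c.
    have [w vw Aw] := H i.
    have wi j : zbil (zstd j) w = 0.
      by apply: (mulfI k0); rewrite -zbilZl vw mulr0.
    suff [c cE] : exists c, zmul (zo 0 0 0 0 0 0 0 b) w = zo 0 0 0 0 0 0 0 c.
      exists (k^-1 * c); apply: (scalerI k0); rewrite -zmulZr Aw cE zoZ.
      by rewrite !mulr0 mulVKf.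
    move: (wi 0) (wi 1) (wi 2%:R); move: (w) => w'; zcoord w'; rewrite /zstd /= !zbilE zmulE.
    by move=> ? ? ?; eexists; apply: eq_zo; [nra..|reflexivity].
  (* These equations say that the upper row of [A] vanishes, and left multiplication by [Y] sees
     only that row. *)
  move: (Ai 0) (Ai 1) (Ai 2%:R); zcoord A; rewrite /zstd /= !zmulE zo0.
  move=> [c /zo_inj [? [? ? ?] [? ? ?] ?]] [c' /zo_inj [? [? ? ?] [? ? ?] ?]].
  move=> [c'' /zo_inj [? [? ? ?] [? ? ?] ?]].
  by apply: eq_zo; nra.
Qed.

Lemma triality_std : triality zstd.
Proof.
split.
  congr half_triality: (half_triality_std (oner_neq0 R)).
  by apply/funext => i; rewrite scale1r.
have n10 : - 1 != 0 :> R by rewrite oppr_eq0 oner_eq0.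
congr half_triality: (half_triality_std n10).
by apply/funext => i; rewrite /zstd /=; zring.
Qed.
End Triality.

(** * Moving an isotropic frame to the standard one by reflections *)

Section Transitivity.
Variable R : realType.
Implicit Types (u w n x : zorn R) (v : 'I_3 -> zorn R).

Definition isotropic_free v :=
  (forall i j, zbil (v i) (v j) = 0) /\
  (forall c : 'I_3 -> R, \sum_i c i *: v i = 0 -> forall i, c i = 0).

Lemma isotropic_free_refl u v : znorm u != 0 ->
  isotropic_free v -> isotropic_free (zrefl u \o v).
Proof.
move=> nu [iso fr]; split=> [i j /=|c]; first by rewrite zbil_refl.
rewrite /= => e; apply: fr; rewrite -[LHS](zreflK nu).
suff -> : zrefl u (\sum_i c i *: v i) = \sum_i c i *: zrefl u (v i).
  by rewrite e; apply: zrefl_orth; rewrite -(scale0r (0 : zorn R)) zbilZl mul0r.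
by rewrite !big_ord_recl !big_ord0 !addr0 !zreflD !zreflZ.
Qed.

(** The reflection in [v k - n] takes [v k] to [n] and fixes the earlier vectors, which are
    orthogonal to both. *)
Lemma triality_move v (k : 'I_3) n : isotropic_free v ->
  znorm n = 0 -> zbil (v k) n != 0 ->
  (forall j : 'I_3, (j < k)%N -> zbil (v j) n = 0) ->
  (forall v', isotropic_free v' -> (forall j : 'I_3, (j < k)%N -> v' j = v j) ->
    v' k = n -> triality v') ->
  triality v.
Proof.
move=> vI nn vkn vjn T.
have nv i : znorm (v i) = 0.
  have := vI.1 i i; rewrite zbilxx => /eqP.
  by rewrite mulf_eq0 pnatr_eq0 /= => /eqP.
have [nu uE] := zrefl_swap (nv k) nn vkn.
apply: (triality_refl nu); apply: T => [|j jk|] //=.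
  exact: isotropic_free_refl.
by apply: zrefl_orth; rewrite zbilDr zbilNr vI.1 vjn // subr0.
Qed.

(** An induction step in the style of Witt's theorem. If [v k] and [zstd R k] are not orthogonal,
    one reflection suffices; otherwise two reflections pass through a null vector [n] orthogonal to
    neither. *)
Lemma triality_step v (k : 'I_3) : isotropic_free v ->
  (forall j : 'I_3, (j < k)%N -> v j = zstd R j) ->
  (zbil (v k) (zstd R k) = 0 -> exists n,
    [/\ znorm n = 0, zbil (v k) n != 0, zbil n (zstd R k) != 0 &
        forall j : 'I_3, (j < k)%N -> zbil (zstd R j) n = 0]) ->
  (forall v', isotropic_free v' ->
    (forall j : 'I_3, (j <= k)%N -> v' j = zstd R j) -> triality v') ->
  triality v.
Proof.
move=> vI vE nE T.
have nstd i : znorm (zstd R i) = 0 by rewrite /zstd; zring.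
have bstd i j : zbil (zstd R i) (zstd R j) = 0 by rewrite /zstd; zring.
have direct v' : isotropic_free v' -> (forall j : 'I_3, (j < k)%N -> v' j = zstd R j) ->
    zbil (v' k) (zstd R k) != 0 -> triality v'.
  move=> v'I v'E v'k; apply: (triality_move v'I (nstd k) v'k) => [j jk|v'' v''I v''E v''k].
    by rewrite v'E.
  apply: T => // j; rewrite leq_eqVlt => /orP[/eqP/val_inj -> //|jk].
  by rewrite v''E // v'E.
have [b0|] := eqVneq (zbil (v k) (zstd R k)) 0; last exact: direct.
have [n [nn vn nk nj]] := nE b0.
apply: (triality_move vI nn vn) => [j jk|v' v'I v'E v'k]; first by rewrite vE // nj.
apply: direct => // [j jk|]; last by rewrite v'k.
by rewrite v'E // vE.
Qed.

Lemma ord3_cases (i : 'I_3) : [\/ i = 0, i = 1 | i = 2%:R].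
Proof.
case: i => [[|[|[|//]]] ?].
- by apply: Or31; apply: val_inj.
- by apply: Or32; apply: val_inj.
- by apply: Or33; apply: val_inj.
Qed.

(** Excludes the degenerate case left over when no coordinate of [v k] provides an intermediate
    vector [n]. *)
Lemma zstd_in_span v (k : 'I_3) (c : 'I_3 -> R) : isotropic_free v ->
  (forall j : 'I_3, (j < k)%N -> v j = zstd R j) ->
  v k = \sum_(j < 3 | (j < k)%N) c j *: zstd R j -> False.
Proof.
move=> [_ fr] vE vk.
suff /fr/(_ k)/eqP : \sum_(i < 3) (if (i < k)%N then c i else - (i == k)%:R) *: v i = 0.
  by rewrite ltnn eqxx oppr_eq0 oner_eq0.
rewrite (bigID (fun j : 'I_3 => (j < k)%N)) /=.
rewrite (eq_bigr (fun j => c j *: zstd R j)); last by move=> j jk; rewrite jk vE.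
rewrite -vk (bigD1 k) ?ltnn //= eqxx scaleN1r big1 ?addr0 ?subrr //.
by move=> j /andP[/negPf -> /negPf ->]; rewrite oppr0 scale0r.
Qed.

Ltac zwit w H :=
  repeat match goal with E : _ = zo _ _ _ _ _ _ _ _ |- _ => clear E end;
  exists w; rewrite /zstd /= ?mulr1n ?mulr0n ?zbilE ?znormE; split;
  [ring|move: H; apply: contraNneq; move=> ?; apply/eqP; lra|
   have := oner_neq0 R; apply: contraNneq; move=> ?; apply/eqP; lra|
   let j := fresh "j" in
   move=> j; case: (ord3_cases j) => -> //= _; rewrite ?mulr1n ?mulr0n zbilE; ring].

(** The three vectors are moved to their standard positions one after the other, and [triality_std]
    concludes. *)
Lemma isotropic_free_triality v : isotropic_free v -> triality v.
Proof.
move=> vI; apply: (triality_step (k := 0) vI) => //.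
  case: (zoP (v 0)) => a [x [y [z [u [v' [w [b vE]]]]]]].
  rewrite vE /zstd /= zbilE mulr1n mulr0n => e.
  (* The first nonzero coordinate of [v 0] dictates the intermediate null vector. Its first lower
     coordinate is always 1, so that it pairs to -1 with [zstd R 0]. If all coordinates vanish,
     [v 0 = 0]. *)
  have [x0|x0] := eqVneq x 0; last by zwit (zo 0 0 0 0 (1 : R) 0 0 0) x0.
  have [y0|y0] := eqVneq y 0; last by zwit (zo 0 0 0 0 (1 : R) 1 0 0) y0.
  have [z0|z0] := eqVneq z 0; last by zwit (zo 0 0 0 0 (1 : R) 0 1 0) z0.
  have [v'0|v'0] := eqVneq v' 0; last by zwit (zo 0 0 1 0 (1 : R) 0 0 0) v'0.
  have [w0|w0] := eqVneq w 0; last by zwit (zo 0 0 0 1 (1 : R) 0 0 0) w0.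
  have [a0|a0] := eqVneq a 0; last by zwit (zo 0 0 0 0 (1 : R) 0 0 1) a0.
  have [b0|b0] := eqVneq b 0; last by zwit (zo 1 0 0 0 (1 : R) 0 0 0) b0.
  exfalso; apply: (zstd_in_span (k := 0) (c := fun=> 0) vI) => //.
  by rewrite big_pred0 // vE zo0; clear vE; apply: eq_zo; lra.
move=> {}v {}vI vE; apply: (triality_step (k := 1) vI).
- by move=> j jk; apply: vE; rewrite -ltnS.
- have := vI.1 1 0; rewrite [v 0]vE //.
  case: (zoP (v 1)) => a [x [y [z [u [v' [w [b v1E]]]]]]].
  rewrite v1E /zstd /= !zbilE !mulr1n !mulr0n => e1 e.
  (* Now the witnesses have first lower coordinate 0, to be orthogonal to [zstd R 0], and cannot
     detect [x]; but if only [x] survives, [v 1] is a multiple of [zstd R 0]. *)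
  have [y0|y0] := eqVneq y 0; last by zwit (zo 0 0 0 0 (0 : R) 1 0 0) y0.
  have [z0|z0] := eqVneq z 0; last by zwit (zo 0 0 0 0 (0 : R) 1 1 0) z0.
  have [w0|w0] := eqVneq w 0; last by zwit (zo 0 0 0 1 (0 : R) 1 0 0) w0.
  have [a0|a0] := eqVneq a 0; last by zwit (zo 0 0 0 0 (0 : R) 1 0 1) a0.
  have [b0|b0] := eqVneq b 0; last by zwit (zo 1 0 0 0 (0 : R) 1 0 0) b0.
  exfalso; apply: (zstd_in_span (k := 1) (c := fun=> x) vI) => [j jk|].
    by apply: vE; rewrite -ltnS.
  rewrite (big_pred1 0); last by move=> i; case: (ord3_cases i) => ->.
  by rewrite v1E /zstd /= !mulr1n !mulr0n zoZ; clear v1E; apply: eq_zo; lra.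
move=> {vE}v {}vI vE; apply: (triality_step (k := 2%:R) vI).
- by move=> j jk; apply: vE; rewrite -ltnS.
- have := vI.1 2%:R 0; have := vI.1 2%:R 1; rewrite [v 0]vE // [v 1]vE //.
  case: (zoP (v 2%:R)) => a [x [y [z [u [v' [w [b v1E]]]]]]].
  rewrite v1E /zstd /= !zbilE !mulr1n !mulr0n => e2 e1 e.
  have [z0|z0] := eqVneq z 0; last by zwit (zo 0 0 0 0 (0 : R) 0 1 0) z0.
  have [a0|a0] := eqVneq a 0; last by zwit (zo 0 0 0 0 (0 : R) 0 1 1) a0.
  have [b0|b0] := eqVneq b 0; last by zwit (zo 1 0 0 0 (0 : R) 0 1 0) b0.
  exfalso.
  apply: (zstd_in_span (k := 2%:R) (c := fun j => if j == 0 then x else y) vI) => [j jk|].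
    by apply: vE; rewrite -ltnS.
  rewrite (bigD1 0) //= (big_pred1 1); last by move=> i; case: (ord3_cases i) => ->.
  by rewrite v1E /zstd /= !mulr1n !mulr0n !zoZ zoD; clear v1E; apply: eq_zo; lra.
move=> {vE}v {}vI vE; have -> : v = @zstd R.
  by apply/funext => i; apply: vE; rewrite -ltnS ltn_ord.
exact: triality_std.
Qed.

End Transitivity.

(** * Calculus *)

Lemma differentiable_fst (K : numFieldType) (V W : normedModType K) (p : V * W) :
  differentiable fst p.
Proof. by apply: linear_differentiable => ?; exact: cvg_fst. Qed.

Lemma differentiable_snd (K : numFieldType) (V W : normedModType K) (p : V * W) :
  differentiable snd p.
Proof. by apply: linear_differentiable => ?; exact: cvg_snd. Qed.

(** * Coordinates on R^{4,4}, and continuity of linear and bilinear maps *)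

Section Coordinates.
Variable R : realType.

(** Linear forms dual to [xi_basis]. They reduce continuity of linear and bilinear maps to finite
    sums, and vector-valued statements to real-valued ones. *)
Definition xi (i : 'I_8) (u : R44 R) : R :=
  [:: u.1.1.1 0 0; u.1.1.1 0 1; u.1.1.1 0 2%:R; u.1.1.2;
      u.1.2 0 0; u.1.2 0 1; u.1.2 0 2%:R; u.2]`_i.

Definition xi_basis (i : 'I_8) : R44 R :=
  let d j := (nat_of_ord i == j)%:R in
  (row3 (d 0%N) (d 1%N) (d 2%N), d 3%N, row3 (d 4%N) (d 5%N) (d 6%N), d 7%N).

Lemma xi_is_linear i : linear (xi i).
Proof.
move=> k u v; rewrite /xi.
by case: i => [[|[|[|[|[|[|[|[|//]]]]]]]] ?]; rewrite /= ?mxE.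
Qed.

HB.instance Definition _ i := GRing.isLinear.Build R (R44 R) R _ (xi i) (xi_is_linear i).

Lemma xi_continuous i : continuous (xi i).
Proof.
have c1 (a : 'I_3) : continuous (fun u : R44 R => u.1.1.1 0 a).
  move=> u; apply: (@continuous_comp _ _ _ (fun u : R44 R => u.1.1.1) (fun M => M 0 a));
    last exact: coord_continuous.
  apply: (@continuous_comp _ _ _ (fun u : R44 R => u.1.1) fst); last exact: cvg_fst.
  by apply: (@continuous_comp _ _ _ (fun u : R44 R => u.1) fst); exact: cvg_fst.
have c2 : continuous (fun u : R44 R => u.1.1.2).
  move=> u; apply: (@continuous_comp _ _ _ (fun u : R44 R => u.1.1) snd); last exact: cvg_snd.
  by apply: (@continuous_comp _ _ _ (fun u : R44 R => u.1) fst); exact: cvg_fst.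
have c3 (a : 'I_3) : continuous (fun u : R44 R => u.1.2 0 a).
  move=> u; apply: (@continuous_comp _ _ _ (fun u : R44 R => u.1.2) (fun M => M 0 a));
    last exact: coord_continuous.
  apply: (@continuous_comp _ _ _ (fun u : R44 R => u.1) snd); last exact: cvg_snd.
  exact: cvg_fst.
have c4 : continuous (fun u : R44 R => u.2) by move=> u; exact: cvg_snd.
by case: i => [[|[|[|[|[|[|[|[|//]]]]]]]] ?];
  [exact: (c1 0)|exact: (c1 1)|exact: (c1 2%:R)|exact: c2|
   exact: (c3 0)|exact: (c3 1)|exact: (c3 2%:R)|exact: c4].
Qed.

Lemma xi_sum (u : R44 R) : u = \sum_i xi i u *: xi_basis i.
Proof.
case: u => [[[x s] y] t].
have [x1 [x2 [x3 ->]]] := row3P x; have [y1 [y2 [y3 ->]]] := row3P y.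
rewrite !big_ord_recl big_ord0 /xi /xi_basis /= !mxE /=.
have sZ k a b c d : k *: ((a, b, c, d) : R44 R) = (k *: a, k * b, k *: c, k * d) by [].
have sD a b c d a' b' c' d' : (a, b, c, d) + (a', b', c', d') =
  (a + a', b + b', c + c', d + d') :> R44 R by [].
rewrite addr0 !sZ !sD !row3Z !row3D.
by rewrite !mulr1 !mulr0 !addr0 !add0r.
Qed.

Lemma linear_R44_continuous (W : normedModType R) (f : {linear R44 R -> W}) :
  continuous f.
Proof.
have -> : f = (\sum_i (fun u => xi i u *: f (xi_basis i))) :> (R44 R -> W).
  by apply/funext => u; rewrite {1}(xi_sum u) linear_sum fct_sumE;
    apply: eq_bigr => i _; rewrite linearZ.
move=> u; apply: differentiable_continuous; apply: differentiable_sum => i.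
by apply: differentiableZl; apply: linear_differentiable; exact: xi_continuous.
Qed.

Lemma bilinear_R44_continuous (W : normedModType R)
    (f : {bilinear R44 R -> R44 R -> W}) :
  continuous (fun p => f p.1 p.2).
Proof.
have -> : (fun p => f p.1 p.2) = (\sum_i \sum_j (fun p =>
    (xi i p.1 * xi j p.2) *: f (xi_basis i) (xi_basis j))) :> (R44 R * R44 R -> W).
  apply/funext => p; rewrite {1}(xi_sum p.1) linear_sumlz fct_sumE.
  apply: eq_bigr => i _; rewrite {1}(xi_sum p.2) linear_sumr fct_sumE.
  by apply: eq_bigr => j _; rewrite linearZl_LR linearZr_LR /= scalerA.
move=> p; apply: differentiable_continuous; apply: differentiable_sum => i.
apply: differentiable_sum => j; apply: differentiableZl; apply: differentiableM.
  apply: differentiable_comp; last by apply: linear_differentiable; exact: xi_continuous.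
  exact: differentiable_fst.
apply: differentiable_comp; last by apply: linear_differentiable; exact: xi_continuous.
exact: differentiable_snd.
Qed.

Lemma diff_bilinear_R44 (V W : normedModType R)
    (f : {bilinear R44 R -> R44 R -> W}) (g h : V -> R44 R) (x v : V) :
  differentiable g x -> differentiable h x ->
  differentiable (fun y => f (g y) (h y)) x /\
  'd (fun y => f (g y) (h y)) x v = f ('d g x v) (h x) + f (g x) ('d h x v).
Proof.
move=> dg dh; pose F (p : R44 R * R44 R) := f p.1 p.2.
have dF : differentiable F (g x, h x).
  by apply: differentiable_bilin; exact: bilinear_R44_continuous.
have dgh := differentiable_pair dg dh.
split; first exact: (differentiable_comp dgh dF).
rewrite (_ : (fun y => _) = F \o (fun y => (g y, h y))) //.
rewrite diff_comp //= diff_pair //= diff_bilin /=; last exact: bilinear_R44_continuous.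
by rewrite addrC.
Qed.

End Coordinates.

(** * Symmetry of mixed second derivatives *)

Section Clairaut.
Variables (R : realType) (V : normedModType R).

Lemma is_derive_line (g : V -> R) (x h : V) (s : R) :
  differentiable g (x + s *: h) ->
  is_derive s 1 (fun s => g (x + s *: h)) ('d g (x + s *: h) h).
Proof.
move=> dg; pose l (r : R) := x + r *: h.
have lD : is_diff s l (0 + *:%R^~ h).
  exact: is_diffD.
have dl : differentiable l s by [].
have dgl : differentiable (g \o l) s by exact: differentiable_comp.
apply: DeriveDef; first exact: diff_derivable.
rewrite [LHS](deriveE _ dgl) diff_comp //= diff_val /=.
by rewrite [(0 + _) 1]add0r scale1r.
Qed.

Lemma MVT_line (g : V -> R) (x h : V) (t : R) : 0 < t ->
  (forall s, 0 <= s <= t -> differentiable g (x + s *: h)) ->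
  exists2 c, 0 < c < t & g (x + t *: h) - g x = t * 'd g (x + c *: h) h.
Proof.
move=> t0 dg; pose f s := g (x + s *: h).
have [||c cI cE] := @MVT R f (fun s => 'd g (x + s *: h) h) 0 t t0.
- move=> s; rewrite in_itv /= => /andP[s0 st].
  by apply: is_derive_line; apply: dg; rewrite !ltW.
- apply: derivable_within_continuous => s; rewrite in_itv /= => sI.
  by have [] := is_derive_line (dg s sI).
exists c; first by move: cI; rewrite in_itv.
by move: cE; rewrite /f scale0r addr0 subr0 mulrC.
Qed.

(** The mean value theorem is used twice: along [h] for the increment of [f] by [t *: k], then along
    [k] for [fh]. *)
Lemma second_difference (f fh : V -> R) (x h k : V) (t : R) : 0 < t ->
  (forall s s', 0 <= s <= t -> 0 <= s' <= t ->
    [/\ differentiable f (x + s *: h + s' *: k),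
        'd f (x + s *: h + s' *: k) h = fh (x + s *: h + s' *: k) &
        differentiable fh (x + s *: h + s' *: k)]) ->
  exists c c', [/\ 0 < c < t, 0 < c' < t &
    f (x + t *: h + t *: k) - f (x + t *: h) - (f (x + t *: k) - f x) =
    t * (t * 'd fh (x + c *: h + c' *: k) k)].
Proof.
move=> t0 H; have tt : 0 <= t <= t by apply/andP; split=> //; exact: ltW.
have t00 : (0 : R) <= 0 <= t by apply/andP; split=> //; exact: ltW.
pose g y := f (y + t *: k) - f y.
have dshift y : differentiable f (y + t *: k) ->
    [/\ differentiable (f \o (fun y => y + t *: k)) y &
     'd (f \o (fun y => y + t *: k)) y h = 'd f (y + t *: k) h].
  move=> df; have sD : is_diff y (fun y => y + t *: k) (id + 0).
    exact: is_diffD.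
  split; first exact: differentiable_comp.
  by rewrite diff_comp //= diff_val /= [(id + 0) h]addr0.
have dg s : 0 <= s <= t -> differentiable g (x + s *: h) /\
    'd g (x + s *: h) h = fh (x + s *: h + t *: k) - fh (x + s *: h).
  move=> sI; have [d1 e1 _] := H s t sI tt; have [d2 e2 _] := H s 0 sI t00.
  rewrite scale0r addr0 in d2 e2; have [d3 e3] := dshift _ d1.
  split; first exact: differentiableB.
  by rewrite -e1 -e2 -e3 diffB.
have [c cI cE] := @MVT_line g x h t t0 (fun s sI => (dg s sI).1).
have cI' : 0 <= c <= t by case/andP: cI => *; rewrite !ltW.
have [|c' c'I c'E] := @MVT_line fh (x + c *: h) k t t0.
  by move=> s sI; have [] := H c s cI' sI.
by exists c, c'; split=> //; rewrite -c'E -(dg c cI').2 -cE.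
Qed.

(** The second difference is symmetric in [h] and [k], so the two mixed derivatives agree at a pair
    of points near [x]; continuity at [x] does the rest. *)
Lemma clairaut (f fh fk : V -> R) (x h k : V) :
  (\forall y \near x, [/\ differentiable f y,
     'd f y h = fh y, 'd f y k = fk y, differentiable fh y & differentiable fk y]) ->
  {for x, continuous (fun y => 'd fh y k)} ->
  {for x, continuous (fun y => 'd fk y h)} ->
  'd fh x k = 'd fk x h.
Proof.
move=> df chk ckh; apply/eqP; rewrite -subr_eq0 -normr_le0.
apply/ler_addgt0Pl => e e0; rewrite addr0.
have e20 : 0 < e / 2 by rewrite divr_gt0.
move/cvgrPdist_lt/(_ _ e20) : chk => chk; move/cvgrPdist_lt/(_ _ e20) : ckh => ckh.
have [r /= r0 rP] := (nbhs_ballP x _).1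
  (@filterI _ (nbhs x) _ _ _ df (@filterI _ (nbhs x) _ _ _ chk ckh)).
(* This size keeps the parallelogram with sides [t *: h] and [t *: k] inside the ball of radius [r];
   the [+ 1] keeps the denominator positive. *)
pose t := r / 2 / (`|h| + `|k| + 1).
have n0 : 0 < `|h| + `|k| + 1 by rewrite ltr_wpDl // addr_ge0.
have t0 : 0 < t by rewrite !divr_gt0.
have inb s s' : 0 <= s <= t -> 0 <= s' <= t -> ball x r (x + s *: h + s' *: k).
  move=> /andP[s0 st] /andP[s'0 s't]; rewrite -ball_normE /ball_ /=.
  rewrite -addrA opprD addrA subrr add0r normrN.
  apply: le_lt_trans (ler_normD _ _) _; rewrite !normrZ !ger0_norm //.
  have : s * `|h| + s' * `|k| <= t * (`|h| + `|k| + 1).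
    rewrite !mulrDr mulr1 -addrA lerD ?ler_wpM2r //.
    by rewrite -[leLHS]addr0 lerD ?ler_wpM2r // ltW.
  rewrite /t divfK ?gt_eqF // => /le_lt_trans; apply.
  by rewrite ltr_pdivrMr // ltr_pMr // ltr1n.
have [c [c' [/andP[c0 ct] /andP[c'0 c't] E1]]] :=
  @second_difference f fh x h k t t0 (fun s s' sI s'I =>
    let: And5 d1 e1 e2 d2 d3 := (rP _ (inb s s' sI s'I)).1 in And3 d1 e1 d2).
have inb' s s' : 0 <= s <= t -> 0 <= s' <= t -> ball x r (x + s *: k + s' *: h).
  by move=> *; rewrite addrAC; exact: inb.
have [d [d' [/andP[d0 dt] /andP[d'0 d't] E2]]] :=
  @second_difference f fk x k h t t0 (fun s s' sI s'I =>
    let: And5 d1 e1 e2 d2 d3 := (rP _ (inb' s s' sI s'I)).1 in And3 d1 e2 d3).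
have cb : ball x r (x + c *: h + c' *: k) by apply: inb; rewrite !ltW.
have db : ball x r (x + d *: k + d' *: h) by apply: inb'; rewrite !ltW.
have [_ [/ltW Hc _]] := rP _ cb; have [_ [_ /ltW Hd]] := rP _ db.
have EE : 'd fh (x + c *: h + c' *: k) k =
          'd fk (x + d *: k + d' *: h) h.
  have tn0 : t != 0 by rewrite gt_eqF.
  apply: (mulfI tn0); apply: (mulfI tn0); rewrite -E1 -E2 [x + t *: k + _]addrAC.
  ring.
rewrite EE in Hc; rewrite distrC in Hd; rewrite (splitr e).
apply: le_trans (lerD Hc Hd).
by rewrite -[X in `|X| <= _](subrKA ('d fk (x + d *: k + d' *: h) h)) ler_normD.
Qed.

End Clairaut.

(** The differential depends only on the germ. This matters because lifts and charts are total
    functions that are meaningful only on open sets. *)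
Lemma near_eq_diff (R : realType) (V W : normedModType R) (f g : V -> W) (x : V) :
  (\near x, f x = g x) -> differentiable f x ->
  differentiable g x /\ 'd g x = 'd f x :> (V -> W).
Proof.
move=> fg df.
have fgx : f x = g x by exact: nbhs_singleton fg.
have E : g \o shift x = cst (g x) + 'd f x +o_ 0 id.
  apply/eqaddoP => e e0.
  have [_ /eqaddoP/(_ e e0)] := (diff_locallyP x f).1 df.
  have H1 : \forall y \near 0, f (y + x) = g (y + x).
    move: fg; rewrite (near_shift 0 x) /=.
    by rewrite subr0.
  by apply: filterS2 H1 => y; rewrite !fctE /= fgx => ->.
have D : 'd g x = 'd f x :> (V -> W).
  by apply: diff_unique => //; exact: diff_continuous.
split=> //; apply/diff_locallyP; rewrite D; split=> //; exact: diff_continuous.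
Qed.

Lemma diff_linear_comp (R : realType) (U V W : normedModType R)
    (L : {linear V -> W}) (f : U -> V) x : continuous L -> differentiable f x ->
  differentiable (L \o f) x /\ 'd (L \o f) x = L \o 'd f x :> (U -> W).
Proof.
move=> Lc df; have dL := linear_differentiable (f x) Lc.
by split; [exact: differentiable_comp|rewrite diff_comp // diff_lin].
Qed.

Lemma near_eq_continuous (R : realType) (V W : normedModType R) (f g : V -> W) x :
  (\near x, f x = g x) -> {for x, continuous f} -> {for x, continuous g}.
Proof.
move=> fg fc; have fcx : f @ x --> f x := fc.
suff : g @ x --> g x by []; rewrite -(nbhs_singleton fg).
by apply: cvg_trans fcx; exact: near_eq_cvg.
Qed.

(** * Smooth maps on open subsets of the plane *)

Section Smooth.
Variable R : realType.

Lemma Ck_on_ext (V : normedModType R) k (U : set 'rV[R]_2) (f g : 'rV[R]_2 -> V) :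
  open U -> (forall x, U x -> f x = g x) -> Ck_on k U f -> Ck_on k U g.
Proof.
move=> Uo; elim: k f g => [|k IH] f g fg /=.
  move=> fc x Ux; apply: near_eq_continuous (fc x Ux).
  by apply: filterS (open_nbhs_nbhs (conj Uo Ux)) => y /fg.
move=> [fd fC]; have D x : U x -> differentiable g x /\ 'd g x = 'd f x :> (_ -> _).
  move=> Ux; apply: near_eq_diff; last exact: fd.
  by apply: filterS (open_nbhs_nbhs (conj Uo Ux)) => y /fg.
split=> [x /D[]//|h]; apply: IH (fC h) => x /D[_ ->] //.
Qed.

Lemma Ck_on_linear (V W : normedModType R) (L : {linear V -> W}) k
    (U : set 'rV[R]_2) (f : 'rV[R]_2 -> V) :
  open U -> continuous L -> Ck_on k U f -> Ck_on k U (L \o f).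
Proof.
move=> Uo Lc; elim: k f => [|k IH] f /=.
  by move=> fc x Ux; apply: continuous_comp (fc x Ux) (Lc _).
move=> [fd fC]; split=> [x /fd/(diff_linear_comp Lc)[]//|h].
apply: Ck_on_ext (IH _ (fC h)) => // x /fd/(diff_linear_comp Lc)[_ ->] //.
Qed.

(** The mean value theorem concerns real functions, hence the passage through the coordinates
    [xi i]. *)
Lemma clairaut_R44 (U : set 'rV[R]_2) (f : 'rV[R]_2 -> R44 R) x h k :
  open U -> Ck_on 2 U f -> U x ->
  'd (fun y => 'd f y h) x k = 'd (fun y => 'd f y k) x h.
Proof.
move=> Uo [fd fC] Ux; rewrite [LHS]xi_sum [RHS]xi_sum; apply: eq_bigr => i _.
congr (_ *: _); have Lc := @xi_continuous R i.
have E v w y : U y -> 'd (xi i \o (fun y => 'd f y v)) y w =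
    xi i ('d (fun y => 'd f y v) y w).
  by move=> Uy; have [_ ->] := diff_linear_comp Lc ((fC v).1 y Uy).
have C v w : {for x, continuous (fun y => 'd (xi i \o (fun y => 'd f y v)) y w)}.
  apply: (@Ck_on_ext _ 0%N U (xi i \o (fun y => 'd (fun y => 'd f y v) y w))) => //.
    by move=> y Uy; rewrite E.
  by apply: (@Ck_on_linear _ _ _ 0%N) => //; exact: (fC v).2.
rewrite -!E //; apply: (@clairaut _ _ (xi i \o f)) => //.
apply: filterS (open_nbhs_nbhs (conj Uo Ux)) => y Uy.
have [d1 e1] := diff_linear_comp Lc (fd y Uy).
split=> //; try by rewrite e1.
  by have [] := diff_linear_comp Lc ((fC h).1 y Uy).
by have [] := diff_linear_comp Lc ((fC k).1 y Uy).
Qed.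

(** Near a point of the open chart image, the continuous [chart_inv a] stays in [W]. *)
Lemma chart_image_open (T : topologicalType) (a : chart R T) (W : set T) :
  open W -> open (chart_map a @` (chart_dom a `&` W)).
Proof.
move=> Wo; rewrite openE => _ [p [ap Wp] <-]; rewrite /interior /=.
have aI : (chart_map a @` chart_dom a) (chart_map a p) by exists p.
have inE q : chart_dom a q -> chart_inv a (chart_map a q) = q.
  by move=> aq; apply: chart_mapK; rewrite inE.
have Ic := @chart_inv_continuous _ _ a.
rewrite continuous_open_subspace in Ic; last exact: chart_img_open.
have {}Ic := Ic (chart_map a p) (mem_set aI).
have : \forall y \near chart_map a p, W (chart_inv a y).
  by apply: Ic; rewrite inE //; apply: open_nbhs_nbhs.
have := open_nbhs_nbhs (conj (@chart_img_open _ _ a) aI).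
apply: filterS2 => _ [q aq <-]; rewrite inE // => Wq.
by exists q.
Qed.

End Smooth.

(** * The Zorn product and form on R^{4,4}; differentiating proportionality *)

Section Rho.
Variable R : realType.
Implicit Types (u v w : R44 R).

Lemma rho_is_linear : linear (@rho R).
Proof.
by move=> k [[[x s] y] t] [[[x' s'] y'] t'] /=; congr (_, _, _, _); rewrite /= opprD scalerN.
Qed.

HB.instance Definition _ :=
  GRing.isLinear.Build R (R44 R) (zorn R) _ (@rho R) rho_is_linear.

Definition rho_inv (Z : zorn R) : R44 R := let '(a, x, y, b) := Z in (x, a, y, - b).

Lemma rhoK : cancel (@rho R) rho_inv.
Proof. by move=> [[[x s] y] t] /=; rewrite opprK. Qed.

Lemma rho_invK : cancel rho_inv (@rho R).
Proof. by move=> [[[a x] y] b] /=; rewrite opprK. Qed.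

Lemma qform_rho v : qform v = - znorm (rho v).
Proof. by case: v => [[[x s] y] t]; rewrite /znorm /= mulrN opprB opprK. Qed.

Definition kmul u v : zorn R := zmul (rho u) (rho v).
Definition kbil u v : R := zbil (rho u) (rho v).
(** A 2 by 2 minor: it expresses proportionality by bilinear equations, to which the product rule
    applies. *)
Definition wedge (i j : 'I_8) u v : R := xi i u * xi j v - xi j u * xi i v.

Lemma kmul_is_bilinear :
  bilinear_for (GRing.Scale.Law.clone _ _ *:%R _) (GRing.Scale.Law.clone _ _ *:%R _) kmul.
Proof.
split=> [v|v] a x y; rewrite /kmul linearP /=.
- by rewrite zmulDl zmulZl.
- by rewrite zmulDr zmulZr.
Qed.
HB.instance Definition _ :=
  bilinear_isBilinear.Build R (R44 R) (R44 R) (zorn R) _ _ kmul kmul_is_bilinear.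

Lemma kbil_is_bilinear :
  bilinear_for (GRing.Scale.Law.clone _ _ *:%R _) (GRing.Scale.Law.clone _ _ *:%R _)
    (kbil : R44 R -> R44 R -> R^o).
Proof.
split=> [v|v] a x y; rewrite /kbil linearP /=.
- by rewrite zbilDl zbilZl.
- by rewrite zbilDr zbilZr.
Qed.
HB.instance Definition _ :=
  bilinear_isBilinear.Build R (R44 R) (R44 R) R^o _ _ kbil kbil_is_bilinear.

Lemma wedge_is_bilinear i j :
  bilinear_for (GRing.Scale.Law.clone _ _ *:%R _) (GRing.Scale.Law.clone _ _ *:%R _)
    (wedge i j : R44 R -> R44 R -> R^o).
Proof.
split=> [v|v] a x y; rewrite /wedge !linearP /= /GRing.scale /=; ring.
Qed.
HB.instance Definition _ i j :=
  bilinear_isBilinear.Build R (R44 R) (R44 R) R^o _ _ (wedge i j) (wedge_is_bilinear i j).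

Lemma xiZ i k u : xi i (k *: u) = k * xi i u.
Proof. by rewrite /xi; case: i => [[|[|[|[|[|[|[|[|//]]]]]]]] ?]; rewrite /= ?mxE. Qed.

Lemma xiB i u v : xi i (u - v) = xi i u - xi i v.
Proof. by rewrite /xi; case: i => [[|[|[|[|[|[|[|[|//]]]]]]]] ?]; rewrite /= ?mxE. Qed.

Lemma wedge_cancel i j k u v w :
  wedge i j u v + wedge i j (k *: v) w = 0 -> wedge i j (u - k *: w) v = 0.
Proof.
rewrite /wedge !xiB !xiZ => e.
by rewrite -[RHS]e; ring.
Qed.

End Rho.

Lemma diff_near0 (R : realType) (V W : normedModType R) (f : V -> W) x h :
  (\near x, f x = 0) -> 'd f x h = 0.
Proof.
move=> f0; have [] := @near_eq_diff R V W (cst 0) f x.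
- by apply: filterS f0 => y ->.
- exact: differentiable_cst.
by move=> _ ->; rewrite diff_cst.
Qed.

(** Differentiating the vanishing minors of [f] and [g] avoids differentiating the factor of
    proportionality: with [k] its value at [x], the minors of ['d f x h - k *: 'd g x h] and [g x]
    vanish. *)
Lemma diff_proportional (R : realType) (V : normedModType R) (f g : V -> R44 R) x h :
  differentiable f x -> differentiable g x -> g x != 0 ->
  (\near x, f x \in <[g x]>%VS) ->
  exists a b, 'd f x h = a *: g x + b *: 'd g x h.
Proof.
move=> df dg gx0 fg.
have /vlineP[k fx] := nbhs_singleton fg.
have [j gj] : exists j, xi j (g x) != 0.
  apply/existsP; apply: contraNT gx0; rewrite negb_exists => /forallP H.
  rewrite (xi_sum (g x)) big1 // => i _.
  by move: (H i); rewrite negbK => /eqP ->; rewrite scale0r.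
have B i : wedge i j ('d f x h - k *: 'd g x h) (g x) = 0.
  have [_ e0] := @diff_bilinear_R44 R V R^o (wedge i j) f g x h df dg.
  have e1 : \near x, wedge i j (f x) (g x) = 0 :> R^o.
    by apply: filterS fg => y /vlineP[c ->]; rewrite /wedge !linearZ /= /GRing.scale /=; ring.
  apply: wedge_cancel; rewrite -fx.
  exact: etrans (esym e0) (diff_near0 h e1).
pose w := 'd f x h - k *: 'd g x h.
(* The first coefficient is read off at a coordinate where [g x] is nonzero. *)
exists (xi j w / xi j (g x)), k.
rewrite -[LHS](subrK (k *: 'd g x h)) -/w; congr (_ + _).
set c := _ / _; rewrite [LHS]xi_sum [g x in RHS]xi_sum scaler_sumr; apply: eq_bigr => i _.
rewrite scalerA; congr (_ *: _).
have := B i; rewrite -/w /wedge => /subr0_eq e.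
by apply: (mulIf gj); rewrite [LHS]e /c; field.
Qed.

Lemma near_eq_diff_comp (R : realType) (U V W : normedModType R)
    (f : V -> W) (t : U -> V) (g : U -> W) x y h :
  t x = y -> (\near x, f (t x) = g x) -> differentiable t x -> differentiable f y ->
  'd g x h = 'd f y ('d t x h).
Proof.
move=> <- ftg dt df.
have [_ ->] := near_eq_diff ftg (differentiable_comp dt df).
by rewrite diff_comp.
Qed.

(** * Lifts and tangent spaces *)

Section Lifts.
Variables (R : realType) (S : smooth_surface R).
Implicit Types (phi : S -> quadric R) (psi : S -> R44 R) (a b : chart R S).
Implicit Types (p q : S) (W : set S).

Lemma chart_invE a p : chart_dom a p -> chart_inv a (chart_map a p) = p.
Proof. by move=> ap; apply: chart_mapK; rewrite inE. Qed.

Lemma near_chart a p W : open W -> W p -> chart_dom a p ->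
  \forall x \near chart_map a p,
    exists q, [/\ chart_dom a q, W q & x = chart_map a q].
Proof.
move=> Wo Wp ap; have o := chart_image_open (a := a) Wo.
have I : (chart_map a @` (chart_dom a `&` W)) (chart_map a p) by exists p.
by apply: filterS (open_nbhs_nbhs (conj o I)) => _ [q [aq Wq] <-]; exists q.
Qed.

Lemma chart_transition a b p : atlas a -> atlas b -> chart_dom a p -> chart_dom b p ->
  differentiable (chart_map a \o chart_inv b) (chart_map b p).
Proof.
move=> Aa Ab ap bp; have [+ _] := atlas_compatible Ab Aa 1%N.
by apply; exists p.
Qed.

Section Lift.
Variables (phi : S -> quadric R) (W : set S) (psi : S -> R44 R).
Hypothesis psiL : local_lift phi W psi.

Lemma lift_Ck k a : atlas a ->
  Ck_on k (chart_map a @` (chart_dom a `&` W)) (psi \o chart_inv a).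
Proof. by case: psiL => _ sm _ Aa; exact: sm. Qed.

Lemma lift_diff a p : atlas a -> chart_dom a p -> W p ->
  differentiable (psi \o chart_inv a) (chart_map a p).
Proof. by move=> Aa ap Wp; have [+ _] := lift_Ck 1 Aa; apply; exists p. Qed.

Lemma lift_neq0 p : W p -> psi p != 0.
Proof. by case: psiL => _ _ + Wp; case/(_ p Wp). Qed.

Lemma lift_line p : W p -> val (phi p) = <[psi p]>%VS.
Proof. by case: psiL => _ _ + Wp; case/(_ p Wp). Qed.

Definition tspan (a : chart R S) p : {vspace R44 R} :=
  (<[psi p]> + limg (linfun (chart_diff psi a p)))%VS.

Lemma tspanP a p w :
  reflect (exists k h, w = k *: psi p + chart_diff psi a p h) (w \in tspan a p).
Proof.
apply: (iffP memv_addP) => [[_ /vlineP[k ->] [_ /memv_imgP[h _ ->] ->]]|[k [h ->]]].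
  by exists k, h; rewrite /chart_diff lfunE.
exists (k *: psi p); first by apply/vlineP; exists k.
exists (chart_diff psi a p h) => //; apply/memv_imgP; exists h; first exact: memvf.
by rewrite /chart_diff lfunE.
Qed.

Lemma tspan_is_tangent_span a p : W p -> atlas a -> chart_dom a p ->
  is_tangent_span phi p (tspan a p).
Proof. by move=> *; exists W, psi, a. Qed.

Lemma chart_diff_transition a b p h : W p ->
  atlas a -> atlas b -> chart_dom a p -> chart_dom b p ->
  chart_diff psi b p h =
  chart_diff psi a p ('d (chart_map a \o chart_inv b) (chart_map b p) h).
Proof.
move=> Wp Aa Ab ap bp; rewrite /chart_diff.
apply: near_eq_diff_comp; first by rewrite /= chart_invE.
- have := near_chart (@chart_dom_open _ _ a) ap bp; apply: filterS => _ [q [bq aq ->]] /=.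
  by rewrite (chart_invE bq) (chart_invE aq).
- exact: chart_transition.
- exact: lift_diff.
Qed.

End Lift.

(** Independence of the lift and of the chart: two lifts are proportional, so [diff_proportional]
    compares their derivatives, and the chain rule changes the chart. A condition on all tangent
    spans thus reduces to a single [tspan]. *)
Lemma tangent_span_sub phi W psi a p V w : local_lift phi W psi -> W p ->
  atlas a -> chart_dom a p -> is_tangent_span phi p V -> w \in V ->
  w \in tspan psi a p.
Proof.
move=> psiL Wp Aa ap [W' [psi' [b [psi'L W'p Ab bp ->]]]] /(tspanP psi' b p)[k [h ->]].
have psi'p q : W q -> W' q -> psi' q \in <[psi q]>%VS.
  by move=> Wq W'q; rewrite -(lift_line psiL Wq) (lift_line psi'L W'q) memv_line.
have /vlineP[k' ->] := psi'p _ Wp W'p.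
have [] := @diff_proportional R _ (psi' \o chart_inv b) (psi \o chart_inv b)
  (chart_map b p) h.
- exact: (lift_diff psi'L).
- exact: (lift_diff psiL).
- by rewrite /= chart_invE // (lift_neq0 psiL).
- have [Wo _ _] := psiL; have [W'o _ _] := psi'L.
  have := near_chart (openI Wo W'o) (conj Wp W'p) bp.
  by apply: filterS => _ [q [bq [Wq W'q] ->]] /=; rewrite chart_invE //; exact: psi'p.
move=> c [d E].
have -> : chart_diff psi' b p h = c *: psi p + d *: chart_diff psi b p h.
  by rewrite -[in c *: psi p](chart_invE bp); exact: E.
rewrite (chart_diff_transition psiL h Wp Aa Ab ap bp).
apply/tspanP; exists (k * k' + c), (d *: 'd (chart_map a \o chart_inv b) (chart_map b p) h).
by rewrite scalerA addrA -scalerDl /chart_diff linearZ.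
Qed.

Definition frame psi a p (i : 'I_3) : zorn R :=
  rho ([:: psi p; chart_diff psi a p (delta_mx 0 0); chart_diff psi a p (delta_mx 0 1)]`_i).

Lemma frame_tspan psi a p (i : 'I_3) : exists2 v, v \in tspan psi a p & frame psi a p i = rho v.
Proof.
eexists; last reflexivity; apply/tspanP.
case: i => [[|[|[|//]]] ?] /=.
- by exists 1, 0; rewrite scale1r /chart_diff linear0 addr0.
- by exists 0, (delta_mx 0 0); rewrite scale0r add0r.
- by exists 0, (delta_mx 0 1); rewrite scale0r add0r.
Qed.

(** Isotropy follows by polarization. A linear relation puts a derivative of the lift on the line of
    [psi p], so the immersion property kills its direction [h], and [psi p != 0] kills the last
    coefficient. *)
Lemma frame_isotropic_free phi W psi a p : totally_isotropic_immersion phi ->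
  local_lift phi W psi -> W p -> atlas a -> chart_dom a p ->
  isotropic_free (frame psi a p).
Proof.
move=> [[_ iso] [_ imm]] psiL Wp Aa ap.
have {}iso := iso p _ (tspan_is_tangent_span psiL Wp Aa ap).
have nrm v : v \in tspan psi a p -> znorm (rho v) = 0.
  by move=> /iso; rewrite qform_rho => /eqP; rewrite oppr_eq0 => /eqP.
split=> [i j|c e i].
  have [v vT ->] := frame_tspan psi a p i; have [w wT ->] := frame_tspan psi a p j.
  by rewrite /zbil -linearD !nrm // ?subr0 // memvD.
pose h : 'rV[R]_2 := c 1 *: delta_mx 0 0 + c 2%:R *: delta_mx 0 1.
have E : c 0 *: psi p + chart_diff psi a p h = 0.
  apply: (can_inj (@rhoK R)); rewrite linear0 -[RHS]e !big_ord_recl big_ord0 addr0.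
  rewrite linearD linearZ /frame /= addrA -addrA; congr (_ + _).
  rewrite /chart_diff [X in rho X]linearD !linearZ linearD !linearZ /=.
  by congr (_ *: _ + _ *: _); congr c; apply: val_inj.
have h0 : h = 0.
  apply: (imm W psi a p psiL Wp Aa ap); apply/vlineP; exists (- c 0).
  by rewrite scaleNr; apply/eqP; rewrite -addr_eq0 addrC E.
have c0 : c 0 = 0.
  move: E; rewrite h0 /chart_diff linear0 addr0 => /eqP.
  by rewrite scaler_eq0 (negPf (lift_neq0 psiL Wp)) orbF => /eqP.
have c1 : c 1 = 0.
  by move/matrixP/(_ 0 0): h0; rewrite !mxE /= mulr1 mulr0 addr0.
have c2 : c 2%:R = 0.
  by move/matrixP/(_ 0 1): h0; rewrite !mxE /= mulr1 mulr0 add0r.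
by case: (ord3_cases i) => ->.
Qed.

Lemma frame_triality phi W psi a p : totally_isotropic_immersion phi ->
  local_lift phi W psi -> W p -> atlas a -> chart_dom a p ->
  triality (frame psi a p).
Proof.
move=> phiI psiL Wp Aa ap; apply: isotropic_free_triality.
exact: (frame_isotropic_free phiI psiL).
Qed.

Lemma rV2_delta (h : 'rV[R]_2) : h = h 0 0 *: delta_mx 0 0 + h 0 1 *: delta_mx 0 1.
Proof.
rewrite {1}(row_sum_delta h) !big_ord_recl big_ord0 addr0.
by congr (_ *: delta_mx _ _ + h _ _ *: delta_mx _ _); apply: val_inj.
Qed.

Lemma frame_killsl psi a p u :
  killsl (rho u) (frame psi a p) <-> forall w, w \in tspan psi a p -> kmul u w = 0.
Proof.
split=> [H w /tspanP[k [h ->]]|H i]; last first.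
  by have [v vT ->] := frame_tspan psi a p i; exact: H.
rewrite /kmul linearD linearZ zmulDr zmulZr (H 0) scaler0 add0r.
rewrite (rV2_delta h) /chart_diff linearD !linearZ linearD !linearZ /=.
by rewrite zmulDr !zmulZr (H 1) (H 2%:R) !scaler0 addr0.
Qed.

Lemma frame_killsr psi a p u :
  killsr (rho u) (frame psi a p) <-> forall w, w \in tspan psi a p -> kmul w u = 0.
Proof.
split=> [H w /tspanP[k [h ->]]|H i]; last first.
  by have [v vT ->] := frame_tspan psi a p i; exact: H.
rewrite /kmul linearD linearZ zmulDl zmulZl (H 0) scaler0 add0r.
rewrite (rV2_delta h) /chart_diff linearD !linearZ linearD !linearZ /=.
by rewrite zmulDl !zmulZl (H 1) (H 2%:R) !scaler0 addr0.
Qed.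

End Lifts.

(** * The maps phi_+ and phi_- *)

Section QuadricPoints.
Variable R : realType.
Implicit Types (z : quadric R) (u v w : R44 R).

Lemma quadric_line z : exists v, val z = <[v]>%VS.
Proof.
case: z => L /= /andP[/eqP dL _].
have : L != 0%VS by rewrite -dimv_eq0 dL.
rewrite -vpick0 => v0; exists (vpick L); apply/eqP.
by rewrite eq_sym eqEdim -memvE memv_pick dim_vline v0 dL.
Qed.

Lemma quadric_line_neq0 z v : val z = <[v]>%VS -> v != 0.
Proof.
case: z => L /= /andP[/eqP + _] LE; rewrite LE dim_vline.
by case: (v != 0).
Qed.

Lemma vlineZ k v : k != 0 -> <[k *: v]>%VS = <[v]>%VS.
Proof.
move=> k0; apply/eqP; rewrite eqEsubv -!memvE memvZ ?memv_line //=.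
by apply/vlineP; exists k^-1; rewrite scalerA mulVf // scale1r.
Qed.

Lemma spanned_byP z (Z : zorn R) : spanned_by z Z -> val z = <[rho_inv Z]>%VS.
Proof.
move=> zZ; apply/vspaceP => v; apply/idP/vlineP => [vz|[k ->]].
  have : [set rho v | v in [set v | v \in val z]] (rho v) by exists v.
  rewrite zZ => -[k _ kZ]; exists k; apply: (can_inj (@rhoK R)).
  by rewrite linearZ /= rho_invK.
have : [set k *: Z | k in [set: R]] (k *: Z) by exists k.
rewrite -zZ => -[w wz wE].
suff -> : k *: rho_inv Z = w by [].
by apply: (can_inj (@rhoK R)); rewrite linearZ /= rho_invK wE.
Qed.

Lemma line_spanned_by z v : val z = <[v]>%VS -> spanned_by z (rho v).
Proof.
move=> zv; apply/seteqP; split=> [_ [w + <-]|_ [k _ <-]].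
  by rewrite /= zv => /vlineP[k ->]; exists k => //; rewrite linearZ.
by exists (k *: v); [rewrite /= zv memvZ // memv_line|rewrite linearZ].
Qed.

Lemma null_in_quadric v : v != 0 -> znorm (rho v) = 0 -> in_quadric <[v]>%VS.
Proof.
move=> v0 nv; rewrite /in_quadric dim_vline v0 /=; apply/asboolP.
by move=> _ /vlineP[k ->]; rewrite qform_rho linearZ /= znormZ nv mulr0 oppr0.
Qed.

End QuadricPoints.

(** * The values of phi_+ and phi_- at a point *)

Section PlusMinus.
Variables (R : realType) (S : smooth_surface R).
Variables (phi : S -> quadric R) (W : set S) (psi : S -> R44 R) (a : chart R S) (p : S).
Hypotheses (phiI : totally_isotropic_immersion phi) (psiL : local_lift phi W psi).
Hypotheses (Wp : W p) (Aa : atlas a) (ap : chart_dom a p).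

Let T := frame_triality phiI psiL Wp Aa ap.

Let psi0 : rho (psi p) != 0.
Proof.
apply: contraNneq (lift_neq0 psiL Wp) => e; apply/eqP.
by apply: (can_inj (@rhoK R)); rewrite e linear0.
Qed.

(** The set under [xget] is inhabited, so the default value does not occur: [half_triality_ex] gives
    an annihilator of the frame, null by [znorm_killed], and [tangent_span_sub] extends it to every
    tangent span. *)
Lemma phi_plusP : exists2 v, val (phi_plus phi p) = <[v]>%VS &
  forall w, w \in tspan psi a p -> kmul v w = 0.
Proof.
suff : exists z : quadric R, exists2 Z, spanned_by z Z &
    forall V, is_tangent_span phi p V ->
    [set rho v | v in [set v | v \in V]] `<=` kerL Z.
  move=> /(xgetPex (phi p)); rewrite -/(phi_plus phi p) => -[Z zZ ZV].
  exists (rho_inv Z); first exact: spanned_byP.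
  move=> w wT; rewrite /kmul rho_invK.
  by apply: (ZV _ (tspan_is_tangent_span psiL Wp Aa ap)); exists w.
have [Z Z0 ZV] := half_triality_ex T.1.
have Z0' : rho_inv Z != 0.
  by apply: contraNneq Z0 => e; rewrite -[Z]rho_invK e linear0.
have nZ : znorm (rho (rho_inv Z)) = 0.
  by rewrite rho_invK; exact: (znorm_killed psi0 (ZV 0)).
exists (Sub _ (null_in_quadric Z0' nZ)), Z.
  by rewrite -[Z in spanned_by _ Z]rho_invK; exact: line_spanned_by.
move=> V VT _ [w wV <-]; rewrite -[Z in kerL Z]rho_invK.
apply: (frame_killsl psi a p (rho_inv Z)).1; first by rewrite rho_invK.
exact: (tangent_span_sub psiL Wp Aa ap VT).
Qed.

Lemma phi_minusP : exists2 v, val (phi_minus phi p) = <[v]>%VS &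
  forall w, w \in tspan psi a p -> kmul w v = 0.
Proof.
suff : exists z : quadric R, exists2 Z, spanned_by z Z &
    forall V, is_tangent_span phi p V ->
    [set rho v | v in [set v | v \in V]] `<=` kerR Z.
  move=> /(xgetPex (phi p)); rewrite -/(phi_minus phi p) => -[Z zZ ZV].
  exists (rho_inv Z); first exact: spanned_byP.
  move=> w wT; rewrite /kmul rho_invK.
  by apply: (ZV _ (tspan_is_tangent_span psiL Wp Aa ap)); exists w.
have [Z' Z'0 Z'V] := half_triality_ex T.2.
(* The second half of triality gives a left annihilator of the conjugated frame, whose conjugate is
   a right annihilator of the frame. *)
pose Z := zconj Z'.
have ZV : killsr Z (frame psi a p).
  move=> i; apply: (can_inj (@zconjK R)).
  by rewrite zconj_mul /Z zconjK [zmul _ _]Z'V zconj0.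
have Z0' : rho_inv Z != 0.
  apply: contraNneq Z'0 => e.
  by rewrite -[Z']zconjK -/Z -[Z]rho_invK e linear0 zconj0.
have nZ : znorm (rho (rho_inv Z)) = 0.
  by rewrite rho_invK; exact: (znorm_killer psi0 (ZV 0)).
exists (Sub _ (null_in_quadric Z0' nZ)), Z.
  by rewrite -[Z in spanned_by _ Z]rho_invK; exact: line_spanned_by.
move=> V VT _ [w wV <-]; rewrite -[Z in kerR Z]rho_invK.
apply: (frame_killsr psi a p (rho_inv Z)).1; first by rewrite rho_invK.
exact: (tangent_span_sub psiL Wp Aa ap VT).
Qed.

(** The criterion for computing [phi_plus]: by [half_triality_uniq], any annihilator that spans a
    point of the quadric determines the value. *)
Lemma phi_plus_unique (z : quadric R) u : val z = <[u]>%VS ->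
  (forall w, w \in tspan psi a p -> kmul u w = 0) -> phi_plus phi p = z.
Proof.
move=> zu uT; have [v zv vT] := phi_plusP.
have v0 : rho v != 0.
  apply: contraNneq (quadric_line_neq0 zv) => e; apply/eqP.
  by apply: (can_inj (@rhoK R)); rewrite e linear0.
have /frame_killsl vK := vT; have /frame_killsl uK := uT.
have [k kE] := half_triality_uniq T.1 v0 vK uK.
have uE : u = k *: v by apply: (can_inj (@rhoK R)); rewrite kE linearZ.
apply: val_inj; rewrite zv zu uE vlineZ //.
apply: contraNneq (quadric_line_neq0 zu) => k0.
by rewrite uE k0 scale0r.
Qed.

End PlusMinus.

(** * Isometric involutions acting on maps to the quadric *)

Section Isometry.
Variables (R : realType) (f : {linear R44 R -> R44 R}).
Hypotheses (fK : involutive f) (fq : forall v, qform (f v) = qform v).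

(** Common form of [c_map] and [sigma_map], which are instances of it up to conversion. *)
Definition quadric_img (z : quadric R) : quadric R :=
  Sub (linfun f @: val z)%VS (in_quadric_img fK fq z).

Lemma quadric_img_line z v : val z = <[v]>%VS -> val (quadric_img z) = <[f v]>%VS.
Proof. by move=> /= ->; rewrite limg_line lfunE. Qed.

Lemma quadric_imgK : involutive quadric_img.
Proof.
move=> z; have [v zv] := quadric_line z; apply: val_inj.
by rewrite (quadric_img_line (quadric_img_line zv)) fK zv.
Qed.

Variable S : smooth_surface R.
Implicit Types (phi : S -> quadric R) (psi : S -> R44 R) (a : chart R S).

Lemma lift_img phi W psi : local_lift phi W psi ->
  local_lift (quadric_img \o phi) W (f \o psi).
Proof.
move=> [Wo sm L]; split=> // [a Aa k|p Wp].
  apply: (@Ck_on_linear _ _ _ f); first exact: chart_image_open.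
    exact: linear_R44_continuous.
  exact: sm.
have [p0 pL] := L p Wp; split; last exact: quadric_img_line.
by apply: contraNneq p0 => /= e; rewrite -[psi p]fK e linear0.
Qed.

Lemma lift_img_inv phi W psi : local_lift (quadric_img \o phi) W psi ->
  local_lift phi W (f \o psi).
Proof.
move=> /lift_img; congr local_lift.
by apply/funext => p /=; rewrite quadric_imgK.
Qed.

Lemma chart_diff_img phi W psi a p h : local_lift phi W psi -> W p ->
  atlas a -> chart_dom a p ->
  chart_diff (f \o psi) a p h = f (chart_diff psi a p h).
Proof.
move=> psiL Wp Aa ap.
have [_ e] := diff_linear_comp (@linear_R44_continuous _ _ f) (lift_diff psiL Aa ap Wp).
exact: (congr1 (@^~ h) e).
Qed.

Lemma tspan_img phi W psi a p w : local_lift phi W psi -> W p ->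
  atlas a -> chart_dom a p -> w \in tspan psi a p -> f w \in tspan (f \o psi) a p.
Proof.
move=> psiL Wp Aa ap /tspanP[k [h ->]]; apply/tspanP; exists k, h.
by rewrite (chart_diff_img h psiL Wp Aa ap) linearD linearZ.
Qed.

Lemma totally_isotropic_immersion_img phi : totally_isotropic_immersion phi ->
  totally_isotropic_immersion (quadric_img \o phi).
Proof.
move=> [[sm iso] [_ imm]].
have sm' : smooth_map (quadric_img \o phi).
  move=> p; have [W [psi [Wp psiL]]] := sm p.
  by exists W, (f \o psi); split=> //; exact: lift_img.
split; split=> //.
  move=> p _ [W [psi [a [psiL Wp Aa ap ->]]]] v vT; rewrite -fq.
  apply: iso (tspan_img psiL Wp Aa ap vT).
  by apply: (tspan_is_tangent_span (lift_img_inv psiL)).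
move=> W psi a p psiL Wp Aa ap h /vlineP[k kE]; apply: (imm _ _ _ _ (lift_img_inv psiL) Wp Aa ap).
by rewrite (chart_diff_img h psiL Wp Aa ap) kE linearZ /= memvZ // memv_line.
Qed.

Hypothesis f_kmul : forall u v, kmul u v = 0 -> kmul (f u) (f v) = 0.

(** [phi_plus] is characterized by tangent spans and zero products alone, and [f] preserves both. *)
Lemma phi_plus_img phi : totally_isotropic_immersion phi ->
  phi_plus (quadric_img \o phi) = quadric_img \o phi_plus phi.
Proof.
move=> phiI; apply/funext => p.
have [[sm _] _] := phiI; have [W [psi [Wp psiL]]] := sm p.
have [a Aa ap] := atlas_cover p.
have [v zv vT] := phi_plusP phiI psiL Wp Aa ap.
apply: (phi_plus_unique (totally_isotropic_immersion_img phiI) (lift_img psiL)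
  Wp Aa ap (quadric_img_line zv)) => w wT.
rewrite -[w]fK; apply: f_kmul; apply: vT.
have /(tspan_img (lift_img psiL) Wp Aa ap) := wT.
by congr (_ \in tspan _ _ _); apply/funext => q /=; rewrite fK.
Qed.

End Isometry.

(** * Differentiating bilinear relations *)

Section BilinearDerivatives.
Variable R : realType.

Lemma rhoN (v : R44 R) : rho (- v) = - rho v.
Proof. by case: v => [[[x s] y] t]. Qed.

Lemma kmulNr (u v : R44 R) : kmul u (- v) = - kmul u v.
Proof. by rewrite /kmul rhoN zmulNr. Qed.

Lemma kbilNr (u v : R44 R) : kbil u (- v) = - kbil u v.
Proof. by rewrite /kbil rhoN zbilNr. Qed.

Lemma diff_bilinear_near0 (V W : normedModType R)
    (f : {bilinear R44 R -> R44 R -> W}) (g h : V -> R44 R) x v :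
  (\near x, f (g x) (h x) = 0) -> differentiable g x -> differentiable h x ->
  f ('d g x v) (h x) + f (g x) ('d h x v) = 0.
Proof.
move=> f0 dg dh; have [_ <-] := diff_bilinear_R44 f v dg dh.
exact: diff_near0.
Qed.

(* The form [kbil ('d f x u) (d2 v h)] is symmetric in [v], [h] by Clairaut
   and antisymmetric in [u], [v], hence zero. *)
Lemma second_derivative_orth (U : set 'rV[R]_2) (f : 'rV[R]_2 -> R44 R) x v h :
  open U -> Ck_on 2 U f -> U x ->
  (forall y u, U y -> kbil (f y) ('d f y u) = 0) ->
  (forall y u w, U y -> kbil ('d f y u) ('d f y w) = 0) ->
  kbil (f x) ('d (fun y => 'd f y v) x h) = 0 /\
  forall u, kbil ('d f x u) ('d (fun y => 'd f y v) x h) = 0.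
Proof.
move=> Uo fC Ux f1 f2; have [fd fdd] := fC.
have nU := open_nbhs_nbhs (conj Uo Ux).
split.
  have H : \near x, kbil (f x) ('d f x v) = 0 :> R^o by apply: filterS nU => y /f1.
  have e : kbil ('d f x h) ('d f x v) + kbil (f x) ('d (fun y => 'd f y v) x h) = 0 :=
    diff_bilinear_near0 h H (fd x Ux) ((fdd v).1 x Ux).
  by move: e; rewrite f2 // add0r.
pose T u v h := kbil ('d f x u) ('d (fun y => 'd f y v) x h).
have kC u w : kbil u w = kbil w u by exact: zbilC.
have TC u w k : T u w k = T u k w.
  by rewrite /T; congr kbil; exact: clairaut_R44 Ux.
have TN u w k : T u w k = - T w u k.
  have H : \near x, kbil ('d f x u) ('d f x w) = 0 :> R^o.
    by apply: filterS nU => y; exact: f2.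
  have e : kbil ('d (fun y => 'd f y u) x k) ('d f x w) + T u w k = 0 :=
    diff_bilinear_near0 k H ((fdd u).1 x Ux) ((fdd w).1 x Ux).
  by move/eqP: e; rewrite kC addrC addr_eq0 => /eqP.
move=> u; rewrite -/(T u v h).
(* Three exchanges of each kind, alternating, lead back to [T u v h] with sign -1. *)
have : T u v h = - T u v h.
  by rewrite {1}TN (TC v) TN opprK (TC h) TN (TC u).
by move=> /eqP; rewrite -addr_eq0 -mulr2n mulrn_eq0 /= => /eqP.
Qed.

End BilinearDerivatives.

(** * Annihilation relations between the tangent spaces of phi, phi_+ and phi_- *)

Section PlusMinusDerivatives.
Variables (R : realType) (S : smooth_surface R).
Variables (phi : S -> quadric R).
Hypothesis phiI : totally_isotropic_immersion phi.
Implicit Types (a : chart R S) (p q : S).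

Lemma kmul_tspan_l psi a p (u : R44 R) : kmul u (psi p) = 0 ->
  (forall h, kmul u (chart_diff psi a p h) = 0) ->
  forall w, w \in tspan psi a p -> kmul u w = 0.
Proof.
move=> u0 uh w /tspanP[k [h ->]]; move: u0 (uh h); rewrite /kmul linearD linearZ /=.
by rewrite zmulDr zmulZr => -> ->; rewrite scaler0 addr0.
Qed.

Lemma kmul_tspan_r psi a p (u : R44 R) : kmul (psi p) u = 0 ->
  (forall h, kmul (chart_diff psi a p h) u = 0) ->
  forall w, w \in tspan psi a p -> kmul w u = 0.
Proof.
move=> u0 uh w /tspanP[k [h ->]]; move: u0 (uh h); rewrite /kmul linearD linearZ /=.
by rewrite zmulDl zmulZl => -> ->; rewrite scaler0 addr0.
Qed.

Lemma lift_in_tspan psi a p : psi p \in tspan psi a p :> bool.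
Proof. by apply/tspanP; exists 1, 0; rewrite scale1r /chart_diff linear0 addr0. Qed.

Lemma chart_diff_in_tspan psi a p h : chart_diff psi a p h \in tspan psi a p.
Proof. by apply/tspanP; exists 0, h; rewrite scale0r add0r. Qed.

Variables (W : set S) (psi : S -> R44 R).
Hypothesis psiL : local_lift phi W psi.

Lemma phi_plus_lift_kills W1 psi1 a p : local_lift (phi_plus phi) W1 psi1 ->
  W p -> W1 p -> atlas a -> chart_dom a p ->
  forall w, w \in tspan psi a p -> kmul (psi1 p) w = 0.
Proof.
move=> psi1L Wp W1p Aa ap w wT.
have [v zv vT] := phi_plusP phiI psiL Wp Aa ap.
have : psi1 p \in <[v]>%VS by rewrite -zv (lift_line psi1L W1p) memv_line.
by move=> /vlineP[k ->]; rewrite /kmul linearZ /= zmulZl [zmul _ _]vT // scaler0.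
Qed.

Lemma phi_minus_lift_kills W2 psi2 a p : local_lift (phi_minus phi) W2 psi2 ->
  W p -> W2 p -> atlas a -> chart_dom a p ->
  forall w, w \in tspan psi a p -> kmul w (psi2 p) = 0.
Proof.
move=> psi2L Wp W2p Aa ap w wT.
have [v zv vT] := phi_minusP phiI psiL Wp Aa ap.
have : psi2 p \in <[v]>%VS by rewrite -zv (lift_line psi2L W2p) memv_line.
by move=> /vlineP[k ->]; rewrite /kmul linearZ /= zmulZr [zmul _ _]vT // scaler0.
Qed.

(** Product rule on the relation [kmul psi1 psi = 0]: the term containing the derivative of [psi]
    vanishes, since [psi1 p] annihilates the whole tangent span of [phi]. *)
Lemma phi_plus_tspan_killed W1 psi1 a p : local_lift (phi_plus phi) W1 psi1 ->
  W p -> W1 p -> atlas a -> chart_dom a p ->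
  forall w, w \in tspan psi1 a p -> kmul w (psi p) = 0.
Proof.
move=> psi1L Wp W1p Aa ap; have K := phi_plus_lift_kills psi1L.
apply: kmul_tspan_r => [|h]; first exact: (K a) (lift_in_tspan _ _ _).
have [Wo _ _] := psiL; have [W1o _ _] := psi1L.
have H : \forall x \near chart_map a p,
    kmul ((psi1 \o chart_inv a) x) ((psi \o chart_inv a) x) = 0.
  apply: filterS (near_chart (openI Wo W1o) (conj Wp W1p) ap).
  move=> _ [q [aq [Wq W1q] ->]] /=; rewrite chart_invE //.
  exact: (K a) (lift_in_tspan _ _ _).
have := diff_bilinear_near0 h H (lift_diff psi1L Aa ap W1p) (lift_diff psiL Aa ap Wp).
rewrite /= !chart_invE // => <-.
have /= -> := K a p Wp W1p Aa ap _ (chart_diff_in_tspan psi a p h).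
by rewrite addr0.
Qed.

Lemma phi_minus_tspan_killed W2 psi2 a p : local_lift (phi_minus phi) W2 psi2 ->
  W p -> W2 p -> atlas a -> chart_dom a p ->
  forall w, w \in tspan psi2 a p -> kmul (psi p) w = 0.
Proof.
move=> psi2L Wp W2p Aa ap; have K := phi_minus_lift_kills psi2L.
apply: kmul_tspan_l => [|h]; first exact: (K a) (lift_in_tspan _ _ _).
have [Wo _ _] := psiL; have [W2o _ _] := psi2L.
have H : \forall x \near chart_map a p,
    kmul ((psi \o chart_inv a) x) ((psi2 \o chart_inv a) x) = 0.
  apply: filterS (near_chart (openI Wo W2o) (conj Wp W2p) ap).
  move=> _ [q [aq [Wq W2q] ->]] /=; rewrite chart_invE //.
  exact: (K a) (lift_in_tspan _ _ _).
have := diff_bilinear_near0 h H (lift_diff psiL Aa ap Wp) (lift_diff psi2L Aa ap W2p).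
rewrite /= !chart_invE // => <-.
have /= -> := K a p Wp W2p Aa ap _ (chart_diff_in_tspan psi a p h).
by rewrite add0r.
Qed.

Lemma lift_second_orth a p v h : W p -> atlas a -> chart_dom a p ->
  forall w, w \in tspan psi a p ->
  kbil w ('d (fun y => 'd (psi \o chart_inv a) y v) (chart_map a p) h) = 0.
Proof.
move=> Wp Aa ap w wT; have [Wo _ _] := psiL.
have Uo := chart_image_open (a := a) Wo.
have nrm q : W q -> chart_dom a q ->
    forall u w, u \in tspan psi a q -> w \in tspan psi a q -> kbil u w = 0.
  move=> Wq aq; have [[_ iso] _] := phiI.
  have {}iso := iso q _ (tspan_is_tangent_span psiL Wq Aa aq).
  have n u : u \in tspan psi a q -> znorm (rho u) = 0.
    by move=> /iso; rewrite qform_rho => /eqP; rewrite oppr_eq0 => /eqP.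
  by move=> u w' uT wT'; rewrite /kbil /zbil -linearD !n ?memvD // !subr0.
have [|||H1 H2] := @second_derivative_orth R _ (psi \o chart_inv a) (chart_map a p) v h Uo
   (lift_Ck psiL 2 Aa).
- by exists p.
- move=> _ u [q [aq Wq] <-]; apply: (nrm q Wq aq); last exact: chart_diff_in_tspan.
  by rewrite /= (chart_invE aq); exact: lift_in_tspan.
- by move=> _ u u' [q [aq Wq] <-]; apply: (nrm q Wq aq); exact: chart_diff_in_tspan.
move: wT => /tspanP[k [g ->]]; move: H1 (H2 g); rewrite /= chart_invE // /kbil.
rewrite linearD linearZ /= zbilDl zbilZl => -> e.
by rewrite mulr0 add0r; exact: e.
Qed.

(** [half_triality_tri] is applied with [A] equal to [psi1 p] and to each derivative of [psi1],
    which together span the tangent space of phi_+. *)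
Lemma phi_minus_kills_plus_tspan W1 psi1 W2 psi2 a p :
  local_lift (phi_plus phi) W1 psi1 -> local_lift (phi_minus phi) W2 psi2 ->
  W p -> W1 p -> W2 p -> atlas a -> chart_dom a p ->
  forall w, w \in tspan psi1 a p -> kmul (psi2 p) w = 0.
Proof.
move=> psi1L psi2L Wp W1p W2p Aa ap.
have K1 := phi_plus_lift_kills psi1L; have K2 := phi_minus_lift_kills psi2L.
have /frame_killsl Zl := K1 a p Wp W1p Aa ap.
have /frame_killsr Yr := K2 a p Wp W2p Aa ap.
have T := half_triality_tri (frame_triality phiI psiL Wp Aa ap).1 Zl Yr.
apply: kmul_tspan_l => [|h]; apply: T => i.
  by exists 0; [move=> j; rewrite -(scale0r (0 : zorn R)) zbilZr mul0r|rewrite Zl zmul0r].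
have [Wo _ _] := psiL; have [W1o _ _] := psi1L.
(* Differentiating [kmul psi1 ('d psi v) = 0] trades the derivative of [psi1] for a second
   derivative of [psi], which becomes the vector [w] of [half_triality_tri]. *)
have D v : kmul (chart_diff psi1 a p h) (chart_diff psi a p v) =
    kmul (psi1 p) (- 'd (fun y => 'd (psi \o chart_inv a) y v) (chart_map a p) h).
  have H : \forall x \near chart_map a p,
      kmul ((psi1 \o chart_inv a) x) ('d (psi \o chart_inv a) x v) = 0.
    apply: filterS (near_chart (openI Wo W1o) (conj Wp W1p) ap).
    move=> _ [q [aq [Wq W1q] ->]] /=; rewrite chart_invE //.
    exact: (K1 a) (chart_diff_in_tspan _ _ _ _).
  have dd : differentiable (fun y => 'd (psi \o chart_inv a) y v) (chart_map a p).
    by apply: ((lift_Ck psiL 2 Aa).2 v).1; exists p.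
  have := diff_bilinear_near0 h H (lift_diff psi1L Aa ap W1p) dd.
  rewrite /= chart_invE // => /eqP; rewrite addr_eq0 => /eqP ->.
  exact: esym (kmulNr _ _).
have orth v j : zbil (frame psi a p j)
    (rho (- 'd (fun y => 'd (psi \o chart_inv a) y v) (chart_map a p) h)) = 0.
  have [u uT ->] := frame_tspan psi a p j.
  have e := lift_second_orth v h Wp Aa ap uT.
  by apply: etrans (kbilNr _ _) _; rewrite e oppr0.
case: (ord3_cases i) => ->.
(* On the frame vector [psi p] the derivative of [psi1] gives 0 by [phi_plus_tspan_killed], so
   [w = 0] works. *)
- exists 0; first by move=> j; rewrite -(scale0r (0 : zorn R)) zbilZr mul0r.
  rewrite zmul0r; apply: (phi_plus_tspan_killed psi1L Wp W1p Aa ap).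
  exact: chart_diff_in_tspan.
- exact: (ex_intro2 _ _ _ (orth (delta_mx 0 0)) (D _)).
- exact: (ex_intro2 _ _ _ (orth (delta_mx 0 1)) (D _)).
Qed.

End PlusMinusDerivatives.

(** * The transformation phi to phi_+ has order 3 *)

Section Rotation.
Variables (R : realType) (S : smooth_surface R) (phi : S -> quadric R).
Hypotheses (phiI : totally_isotropic_immersion phi).
Hypotheses (plusI : immersion (phi_plus phi)) (minusI : immersion (phi_minus phi)).

Let lift_at p : exists W psi, W p /\ local_lift phi W psi.
Proof. by have [[sm _] _] := phiI; exact: sm. Qed.

(** Every tangent vector of phi_+ annihilates the nonzero [psi p] from the left, hence is null. *)
Lemma phi_plus_totally_isotropic_immersion : totally_isotropic_immersion (phi_plus phi).
Proof.
split; [split|exact: plusI]; first exact: plusI.1.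
move=> p _ [W1 [psi1 [a [psi1L W1p Aa ap ->]]]] w wT.
have [W [psi [Wp psiL]]] := lift_at p.
have := phi_plus_tspan_killed phiI psiL psi1L Wp W1p Aa ap wT.
move=> /(znorm_killed _) n; rewrite qform_rho n ?oppr0 //.
apply: contraNneq (lift_neq0 psiL Wp) => e; apply/eqP.
by apply: (can_inj (@rhoK R)); rewrite e linear0.
Qed.

Lemma phi_minus_totally_isotropic_immersion : totally_isotropic_immersion (phi_minus phi).
Proof.
split; [split|exact: minusI]; first exact: minusI.1.
move=> p _ [W2 [psi2 [a [psi2L W2p Aa ap ->]]]] w wT.
have [W [psi [Wp psiL]]] := lift_at p.
have := phi_minus_tspan_killed phiI psiL psi2L Wp W2p Aa ap wT.
move=> /(znorm_killer _) n; rewrite qform_rho n ?oppr0 //.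
apply: contraNneq (lift_neq0 psiL Wp) => e; apply/eqP.
by apply: (can_inj (@rhoK R)); rewrite e linear0.
Qed.

Lemma phi_plus_plus : phi_plus (phi_plus phi) = phi_minus phi.
Proof.
apply/funext => p; have [W [psi [Wp psiL]]] := lift_at p.
have [W1 [psi1 [W1p psi1L]]] := plusI.1 p.
have [W2 [psi2 [W2p psi2L]]] := minusI.1 p.
have [a Aa ap] := atlas_cover p.
apply: (phi_plus_unique phi_plus_totally_isotropic_immersion psi1L W1p Aa ap
  (lift_line psi2L W2p)).
exact: (phi_minus_kills_plus_tspan phiI psiL psi1L psi2L).
Qed.

Lemma phi_plus_minus : phi_plus (phi_minus phi) = phi.
Proof.
apply/funext => p; have [W [psi [Wp psiL]]] := lift_at p.
have [W2 [psi2 [W2p psi2L]]] := minusI.1 p.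
have [a Aa ap] := atlas_cover p.
apply: (phi_plus_unique phi_minus_totally_isotropic_immersion psi2L W2p Aa ap
  (lift_line psiL Wp)).
exact: (phi_minus_tspan_killed phiI psiL psi2L).
Qed.

End Rotation.

(** * The composite of sigma and c *)

Section SigmaC.
Variable R : realType.

Definition sigmac_vec : {linear R44 R -> R44 R} := @sigma_vec R \o @c_vec R.

Lemma sigmac_vecK : involutive sigmac_vec.
Proof. by move=> [[[x s] y] t]. Qed.

Lemma qform_sigmac_vec v : qform (sigmac_vec v) = qform v.
Proof. by rewrite /= qform_sigma_vec qform_c_vec. Qed.

Definition zflip (Z : zorn R) : zorn R := let '(a, x, y, b) := Z in (- b, y, x, - a).

Lemma rho_sigmac u : rho (sigmac_vec u) = zflip (rho u).
Proof. by case: u => [[[x s] y] t]; rewrite /= opprK. Qed.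

(* [- zflip] is an automorphism of the Zorn algebra. *)
Lemma zmul_flip X Y : zmul (zflip X) (zflip Y) = - zflip (zmul X Y).
Proof.
have E a x y z u v w b : zflip (zo a x y z u v w b) = zo (- b) u v w x y z (- a) by [].
by zcoord X; zcoord Y; rewrite !E !zmulE E; zring.
Qed.

(** The sign in [zmul_flip] does not affect zero products. *)
Lemma kmul_sigmac u v : kmul u v = 0 -> kmul (sigmac_vec u) (sigmac_vec v) = 0.
Proof.
rewrite /kmul !rho_sigmac zmul_flip => ->.
by rewrite /zflip /= oppr0; apply/eqP; rewrite oppr_eq0.
Qed.

Definition sigmac_map := quadric_img sigmac_vecK qform_sigmac_vec.

Lemma sigmac_mapE z : sigma_map (c_map z) = sigmac_map z.
Proof.
have [v zv] := quadric_line z; apply: val_inj.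
rewrite (quadric_img_line _ _ zv).
have cv := quadric_img_line (@c_vecK R) (@qform_c_vec R) zv.
exact: (quadric_img_line (@sigma_vecK R) (@qform_sigma_vec R) cv).
Qed.

End SigmaC.

(** * Iterating D after A *)

Section TransfDA.
Variables (R : realType) (S : smooth_surface R).
Implicit Types phi : S -> quadric R.

(** Both partial transformations are defined: the map given to [transfD] is the image of phi_+ under
    the isometry c, hence again a totally isotropic immersion. *)
Lemma transfDA_plus phi : totally_isotropic_immersion phi ->
  totally_isotropic_immersion (phi_plus phi) ->
  transfDA phi = Some (@sigmac_map R \o phi_plus phi).
Proof.
move=> phiI plusI; rewrite /transfDA /transfA; case: asboolP => //= _.
rewrite /transfD; case: asboolP => [_|]; last first.
  by case; exact: (totally_isotropic_immersion_img (@c_vecK R) (@qform_c_vec R) plusI).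
by congr Some; apply/funext => p /=; rewrite sigmac_mapE.
Qed.

(** [sigmac_map] commutes with [phi_plus], so its two occurrences cancel. *)
Lemma transfDA_sigmac_plus phi : totally_isotropic_immersion phi ->
  totally_isotropic_immersion (phi_plus phi) ->
  transfDA (@sigmac_map R \o phi) = Some (phi_plus phi).
Proof.
move=> phiI plusI.
have plusE := phi_plus_img (@sigmac_vecK R) (@qform_sigmac_vec R) (@kmul_sigmac R) phiI.
rewrite transfDA_plus; first last.
- by rewrite plusE; exact: totally_isotropic_immersion_img.
- exact: totally_isotropic_immersion_img.
by congr Some; rewrite plusE; apply/funext => p /=; exact: quadric_imgK.
Qed.

End TransfDA.

Theorem mainTheorem4 (R : realType) (S : smooth_surface R)
    (phi : S -> quadric R)
    (phi_imm : totally_isotropic_immersion phi)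
    (phi_plus_imm : immersion (phi_plus phi))
    (phi_minus_imm : immersion (phi_minus phi)) :
  iter 6 (obind (@transfDA R S)) (Some phi) = Some phi.
Proof.
have plusI := phi_plus_totally_isotropic_immersion phi_imm phi_plus_imm.
have minusI := phi_minus_totally_isotropic_immersion phi_imm phi_minus_imm.
have plus2 := phi_plus_plus phi_imm phi_plus_imm phi_minus_imm.
have plus3 := phi_plus_minus phi_imm phi_minus_imm.
(* With s for [sigmac_map], the orbit is phi, s phi_+, phi_-, s phi, phi_+, s phi_-, phi. *)
rewrite /= transfDA_plus //= transfDA_sigmac_plus //=; last by rewrite plus2.
rewrite plus2 transfDA_plus //=; last by rewrite plus3.
rewrite plus3 transfDA_sigmac_plus //= transfDA_plus //=; last by rewrite plus2.
by rewrite plus2 transfDA_sigmac_plus ?plus3.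
Qed.
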